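(* Let $H$ and $K$ be even embeddings of a closed surface $F^2$ whose minimal degree is at least $3$. If $S(H)$ is not isomorphic to $S(K)$, then $S(K)$ cannot be obtained from $S(H)$ by a sequence of balanced subdivisions and balanced welds.
   Context: An even embedding of a closed surface $F^2$ is a graph embedded on $F^2$ such that each face is bounded by a cycle of even length. For an even embedding $H$, its face subdivision $S(H)$ is the triangulation of $F^2$ obtained from $H$ by adding a new vertex in each face of $H$ and joining it to all vertices on the boundary cycle of that face; $S(H)$ is balanced. A triangulation of $F^2$ is a simple graph embedded on $F^2$ such that every face is bounded by a $3$-cycle and any two faces share at most one edge; it is balanced if its graph is $3$-colorable; a face on $a,b,c$ is written $abc$. The following operations must produce again a triangulation (no multiple edges), and every triangle named is a face. BT-subdivision: for a face $abc$, introduce new vertices $a',b',c'$ (colored as $a,b,c$ respectively), delete face $abc$ and add the seven faces $abc', ab'c, a'bc, ab'c', a'bc', a'b'c, a'b'c'$. BT-weld: the inverse. BE-subdivision: for an edge $sw$ contained in faces $asw$ and $bsw$, introduce new vertices $p$ (colored as $s$) and $q$ (colored as $w$), delete faces $asw,bsw$ and edge $sw$, add faces $asq, apq, apw, bsq, bpq, bpw$. BE-weld: the inverse. Balanced subdivisions are BT- and BE-subdivisions; balanced welds are BT- and BE-welds. *)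

(* Defs.v *)
From HB Require Import structures.
From mathcomp Require Import all_boot all_order all_algebra.
From mathcomp Require Import all_classical all_reals topology normedtype.

Set Implicit Arguments.
Unset Strict Implicit.
Unset Printing Implicit Defensive.

Import Order.TTheory GRing.Theory Num.Theory.
Import numFieldNormedType.Exports.

Local Open Scope ring_scope.

Definition homeomorphic (X Y : topologicalType)
    (A : classical_sets.set X) (B : classical_sets.set Y) : Prop :=
  exists (f : X -> Y) (g : Y -> X),
    [/\ (forall x, A x -> B (f x)) /\ ({within A, continuous f})%classic,
        (forall y, B y -> A (g y)) /\ ({within B, continuous g})%classic,
        forall x, A x -> g (f x) = x
      & forall y, B y -> f (g y) = y].

(* Second countability follows from compactness and the existence of charts. *)
Definition closed_surface (R : realType) (F : topologicalType) : Prop :=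
  [/\ hausdorff_space F, compact [set: F]%classic, connected [set: F]%classic,
      exists x : F, True
    & forall x : F, exists U : classical_sets.set F,
        [/\ open U, U x & homeomorphic U [set: 'rV[R]_2]%classic]].

(* A finite pure 2-dimensional complex, given by its triangles.  Its graph is *)
(* automatically simple, and distinct triangles share at most one edge since  *)
(* a triangle is identified with its set of three vertices.                   *)
Record complex := Complex { vert :> finType; faces : {set {set vert}} }.

Definition tri (V : finType) (a b c : V) : {set V} := [set a; b; c]%SET.

Definition cadj (T : complex) : rel T :=
  fun u v => (u != v) && [exists f in faces T, (u \in f) && (v \in f)].

Definition isomorphic (T T' : complex) : Prop :=
  exists phi : T -> T', bijective phi /\
    forall f : {set T}, (f \in faces T) = (phi @: f \in faces T')%SET.

(* The geometric realization: the points given by barycentric coordinates on  *)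
(* the vertices whose support lies in a triangle.                             *)
Definition realization (R : realType) (T : complex) :
    classical_sets.set 'rV[R]_#|T| :=
  fun x => [/\ forall i, 0 <= x ord0 i, \sum_i x ord0 i = 1
    & exists2 f, f \in faces T &
        forall v : T, v \notin f -> x ord0 (enum_rank v) = 0].

Arguments realization : clear implicits.

(* Every edge lies in two triangles and every vertex link is connected, hence *)
(* a cycle.                                                                   *)
Definition surface_complex (T : complex) : Prop :=
  [/\ forall f, f \in faces T -> #|f| = 3%N,
      forall v : T, exists2 f, f \in faces T & v \in f,
      forall u v : T, cadj u v ->
        #|[set f in faces T | (u \in f) && (v \in f)]%SET| = 2%N,
      forall v x y : T, cadj v x -> cadj v y ->
        connect (fun x y => tri v x y \in faces T) x y
    & forall u v : T, connect (@cadj T) u v].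

Definition triangulation (R : realType) (F : topologicalType) (T : complex) :
    Prop :=
  surface_complex T /\ homeomorphic (realization R T) [set: F]%classic.

Definition proper_coloring (T : complex) (k : T -> 'I_3) : Prop :=
  forall u v : T, cadj u v -> k u != k v.

(* A simple graph with its facial walks.  Faces are indexed, since distinct   *)
(* faces may have the same vertices.                                          *)
Record embedded_graph := EmbeddedGraph {
  gvert :> finType;
  gadj : rel gvert;
  gface : finType;
  facial : gface -> seq gvert }.

Definition cycle_edge (V : eqType) (c : seq V) (u v : V) : bool :=
  [&& u \in c, v \in c & (next c u == v) || (next c v == u)].

Definition face_subdivision (H : embedded_graph) : complex :=
  @Complex (H + gface H)%type
    [set A | [exists f, exists u, exists v, cycle_edge (facial f) u v &&
                (A == tri (inr f) (inl u) (inl v))]]%SET.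

(* The combinatorial conditions say that glueing a polygon along each facial  *)
(* cycle gives a closed surface: an edge lies on two of the polygons, and the *)
(* polygons around a vertex form a single cyclic sequence.  The glued surface *)
(* is realized by coning each polygon from an interior point, which is what   *)
(* the realization of the face subdivision does: the homeomorphism embeds the *)
(* graph in F, and its faces are the open stars of the cone points.           *)
Definition even_embedding (R : realType) (F : topologicalType)
    (H : embedded_graph) : Prop :=
  [/\ symmetric (@gadj H) /\ irreflexive (@gadj H),
      forall f : gface H, [/\ (2 < size (facial f))%N,
        ~~ odd (size (facial f)), uniq (facial f) & cycle (@gadj H) (facial f)],
      (forall u v : H, gadj u v ->
         #|[set f : gface H | cycle_edge (facial f) u v]%SET| = 2%N) /\
      (forall (v : H) (f g : gface H), v \in facial f -> v \in facial g ->
         connect (fun f g => [exists u : H,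
           cycle_edge (facial f) u v && cycle_edge (facial g) u v]) f g),
      forall u v : H, connect (@gadj H) u v
    & homeomorphic (realization R (face_subdivision H)) [set: F]%classic].

Definition min_degree_ge (d : nat) (H : embedded_graph) : Prop :=
  forall v : H, (d <= #|[set u | gadj v u]%SET|)%N.

(* i identifies the vertices of T with old vertices of T', the others being   *)
(* the entries of news; the colorings k and k' agree on the old vertices, and *)
(* each new vertex is colored as the corresponding entry of olds.             *)
Definition new_vertices (T T' : complex) (i : T -> T')
    (news : seq T') (olds : seq T) : Prop :=
  [/\ injective i, uniq news, forall x, (x \in news) = (x \notin codom i)
    & exists (k : T -> 'I_3) (k' : T' -> 'I_3),
        [/\ proper_coloring k, proper_coloring k',
            forall v, k' (i v) = k v & map k' news = map k olds]].

Definition image_faces (T T' : complex) (i : T -> T') (S : {set {set T}}) :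
    {set {set T'}} :=
  [set i @: (f : {set T}) | f in S]%SET.

Definition BT_subdivision (R : realType) (F : topologicalType)
    (T T' : complex) : Prop :=
  [/\ triangulation R F T, triangulation R F T'
    & exists (i : T -> T') (a b c : T) (a' b' c' : T'),
      [/\ tri a b c \in faces T,
          new_vertices i [:: a'; b'; c'] [:: a; b; c]
        & faces T' =
            (image_faces i (faces T :\ tri a b c) :|:
             [set tri (i a) (i b) c'; tri (i a) b' (i c); tri a' (i b) (i c);
                  tri (i a) b' c'; tri a' (i b) c'; tri a' b' (i c);
                  tri a' b' c'])%SET]].

Definition BE_subdivision (R : realType) (F : topologicalType)
    (T T' : complex) : Prop :=
  [/\ triangulation R F T, triangulation R F T'
    & exists (i : T -> T') (a b s w : T) (p q : T'),
      [/\ [/\ a != b, tri a s w \in faces T & tri b s w \in faces T],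
          new_vertices i [:: p; q] [:: s; w]
        & faces T' =
            (image_faces i (faces T :\ tri a s w :\ tri b s w) :|:
             [set tri (i a) (i s) q; tri (i a) p q; tri (i a) p (i w);
                  tri (i b) (i s) q; tri (i b) p q; tri (i b) p (i w)])%SET]].

Definition balanced_subdivision (R : realType) (F : topologicalType)
    (T T' : complex) : Prop :=
  BT_subdivision R F T T' \/ BE_subdivision R F T T'.

Definition balanced_weld (R : realType) (F : topologicalType)
    (T T' : complex) : Prop :=
  balanced_subdivision R F T' T.

(* Triangulations are considered up to isomorphism. *)
Inductive obtained (R : realType) (F : topologicalType) :
    complex -> complex -> Prop :=
| obtained_iso T T' : isomorphic T T' -> obtained R F T T'
| obtained_subdivision T T1 T' :
    balanced_subdivision R F T T1 -> obtained R F T1 T' -> obtained R F T T'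
| obtained_weld T T1 T' :
    balanced_weld R F T T1 -> obtained R F T1 T' -> obtained R F T T'.

(* Main.v *)
(** A balanced triangulation is encoded by its set of faces with three
    involutions [r c], where [r c f] is the face across the edge of [f]
    opposite to the vertex of colour [c]; vertices become two-coloured
    cycles. On such "gems" the welds no longer have to avoid multiple
    edges, and they are generated by two moves: cancelling two faces that
    share two edges (a dipole), and shortening a strip of faces around two
    adjacent vertices of degree 4 (a ladder). A BE-weld shortens one
    ladder; a BT-weld shortens one ladder and then cancels one dipole.
    Both moves delete disjoint pairs of adjacent faces and reconnect what
    is left, and such deletions commute, so the rewriting system is
    locally confluent up to isomorphism; it terminates because faces
    disappear. If H has minimal degree at least 3, then S(H) has no two
    adjacent vertices of degree 4, so its gem is a normal form. Uniqueness
    of normal forms then makes S(H) and S(K) isomorphic as soon as they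
    are connected by subdivisions and welds. *)

Require Import Defs.
From mathcomp Require Import all_boot all_fingroup.
From mathcomp Require Import boolp.

Set Implicit Arguments.
Unset Strict Implicit.
Unset Printing Implicit Defensive.

(** * Colored involutions and their reductions *)

(** Welds are partial operations on triangulations: performing one may forbid another, so a diagram
    of welds need not close there. Gems supply the missing intermediate objects, in particular
    vertices of degree 2, which are the dipoles. All gems of one reduction live on the same type, so
    independent deletions commute as an equality of functions. Isomorphism enters for two reasons: a
    ladder can be shortened at either end, with different surviving faces, and each subdivision
    brings its own colouring, determined only up to a permutation of colours. Overlapping moves stay
    manageable because there are only three colours: two pairs of colours always share one, and two
    ladders with different rung colours can both be shortened along the third. *)

(* Deleted points are kept as fixed points. *)
Definition cut (X : eqType) (f : X -> X) (x y u : X) : X :=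
  if (u == x) || (u == y) then u
  else if f u == x then f y else if f u == y then f x else f u.

(* Innermost tests first, so that an [if] is never itself compared. *)
Ltac case_eqs := repeat match goal with |- context [?a == ?b] =>
  lazymatch constr:((a, b)) with
  | context [if _ then _ else _] => fail
  | _ => case: (a =P b) => /= ?; try congruence
  end end.

Section Cut.
Variables (X : eqType) (f : X -> X).
Hypothesis fK : involutive f.

Lemma cutC x y : cut f x y = cut f y x.
Proof.
apply: funext => u; rewrite /cut orbC; case: ifP => // _.
by case: (f u =P x) => [->|//]; case: (x =P y) => [->|//].
Qed.

Lemma cut_in x y u : u \in [:: x; y] -> cut f x y u = u.
Proof. by rewrite /cut !inE => ->. Qed.

Lemma cut_out x y u : u \notin [:: x; y] -> f u \notin [:: x; y] ->
  cut f x y u = f u.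
Proof. by rewrite /cut !inE => /negbTE -> /norP[/negbTE -> /negbTE ->]. Qed.

Lemma cut_through x y u : u \notin [:: x; y] -> f u = x -> cut f x y u = f y.
Proof. by rewrite /cut !inE => /negbTE -> ->; rewrite eqxx. Qed.

(** Rerouting would fix [u] only if [u] were matched with both [x] and [y]. So cutting out two
    points kills no third one. *)
Lemma cut_fix x y u : x != y -> u \notin [:: x; y] ->
  (cut f x y u == u) = (f u == u).
Proof.
rewrite /cut !inE => xy /norP[ux uy]; rewrite (negbTE ux) (negbTE uy) /=.
have e z w : f z = w -> f w = z by move<-.
case: (f u =P x) => [fx|_].
  apply/eqP/eqP => [/e fu|fu]; last by rewrite -fu fx eqxx in ux.
  by rewrite -fu fx eqxx in xy.
case: (f u =P y) => [fx|//].
apply/eqP/eqP => [/e fu|fu]; last by rewrite -fu fx eqxx in uy.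
by rewrite -fu fx eqxx in xy.
Qed.

(** If [f x = x], the partner of [y] would be rerouted to [x], which is now fixed; hence the
    conditions on fixed points. *)
Lemma cutK x y : f x != x -> f y != y -> x != y -> involutive (cut f x y).
Proof.
move=> /eqP fx /eqP fy /eqP xy u; rewrite /cut.
have fu := fK u; have ffx := fK x; have ffy := fK y.
case_eqs.
Qed.

(** Both sides send a surviving point to the first survivor reached by alternately following [f] and
    jumping between [x] and [y] or between [x'] and [y']; this path does not depend on the order of
    the cuts. *)
Lemma cut_comm x y x' y' : uniq [:: x; y; x'; y'] ->
  f x != x -> f y != y -> f x' != x' -> f y' != y' ->
  cut (cut f x y) x' y' = cut (cut f x' y') x y.
Proof.
rewrite /= !inE !negb_or =>
  /and4P[/and3P[/eqP ? /eqP ? /eqP ?] /andP[/eqP ? /eqP ?] /eqP ? _].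
move=> /eqP ? /eqP ? /eqP ? /eqP ?; apply: funext => u; rewrite /cut.
have fu := fK u; have ffx := fK x; have ffy := fK y.
have ffx' := fK x'; have ffy' := fK y'.
case_eqs.
Qed.
End Cut.

(* The common fixed points of the three involutions are the deleted faces. *)
Record is_gem (X : eqType) (r : 'I_3 -> X -> X) : Prop := IsGem {
  gemK : forall c, involutive (r c);
  gem_fix : forall c d x, r c x = x -> r d x = x }.

Definition alive (X : eqType) (r : 'I_3 -> X -> X) (x : X) : bool :=
  r ord0 x != x.

(** For each colour, the neighbours left over by [x] and [y] are glued together; when [x] and [y]
    are adjacent, this closes the hole left by the two faces. *)
Definition excise (X : eqType) (r : 'I_3 -> X -> X) (x y : X) :=
  fun c => cut (r c) x y.

(** The vertex of the third colour has degree 2: its star is [x] and [r i x]. *)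
Definition dipole (X : eqType) (r : 'I_3 -> X -> X) (i j : 'I_3) (x : X) :=
  [/\ i != j, alive r x & r i x = r j x].

(* The edge from x to r i x is the middle one of three rungs of colour i; the *)
(* two squares are the links of adjacent vertices of degree 4, and the        *)
(* inequalities say that the three rungs are disjoint.                        *)
Record ladder (X : eqType) (r : 'I_3 -> X -> X) (i j k : 'I_3) (x : X) :
  Prop := Ladder {
  ladder_colors : uniq [:: i; j; k];
  ladder_alive : alive r x;
  ladder_sqj : r i (r j x) = r j (r i x);
  ladder_sqk : r i (r k x) = r k (r i x);
  ladder_ij : r j x <> r i x;
  ladder_ik : r k x <> r i x;
  ladder_jk : r j x <> r k x;
  ladder_jik : r j x <> r k (r i x) }.

(* Deletes the middle rung and one outer rung, leaving the other one in place *)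
(* of the ladder.                                                             *)
Definition contract (X : eqType) (r : 'I_3 -> X -> X) (i j : 'I_3) (x : X) :=
  excise (excise r x (r j x)) (r i x) (r j (r i x)).

Inductive step (X : eqType) (r : 'I_3 -> X -> X) : ('I_3 -> X -> X) -> Prop :=
| step_dipole i j x : dipole r i j x -> step r (excise r x (r i x))
| step_ladder i j k x : ladder r i j k x -> step r (contract r i j x).

Inductive steps (X : eqType) : ('I_3 -> X -> X) -> ('I_3 -> X -> X) -> Prop :=
| steps_refl r : steps r r
| steps_step r r1 r2 : step r r1 -> steps r1 r2 -> steps r r2.

(** Colours may be permuted, as a colouring is unique only up to a permutation. The maps matter on
    alive faces only, so a reduced gem can be compared with one on another type. *)
Record giso_by (X Y : eqType) (s : {perm 'I_3}) (f : X -> Y) (g : Y -> X)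
    (r : 'I_3 -> X -> X) (r' : 'I_3 -> Y -> Y) : Prop := GisoBy {
  giso_alive : forall x, alive r x -> alive r' (f x);
  giso_alive' : forall y, alive r' y -> alive r (g y);
  giso_fK : forall x, alive r x -> g (f x) = x;
  giso_gK : forall y, alive r' y -> f (g y) = y;
  giso_comm : forall c x, alive r x -> f (r c x) = r' (s c) (f x) }.

Definition giso (X Y : eqType) (r : 'I_3 -> X -> X) (r' : 'I_3 -> Y -> Y) :=
  exists s f g, @giso_by X Y s f g r r'.

Ltac uniq_cases H :=
  move: H; rewrite /= ?inE ?negb_or; let H := fresh "H" in move=> H;
  repeat match goal with
  | H : is_true (_ && _) |- _ => let H1 := fresh "H" in case/andP: H => H H1
  | H : is_true (_ != _) |- _ => move/eqP in H
  end.

Ltac uniq_solve :=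
  rewrite /= ?inE ?negb_or; repeat (apply/andP; split=> //);
  try (apply/eqP; congruence).

Lemma colors3 (i j k : 'I_3) : uniq [:: i; j; k] ->
  forall c, [\/ c = i, c = j | c = k].
Proof.
move=> u c; suff /or3P[/eqP|/eqP|/eqP] : [|| c == i, c == j | c == k].
- by constructor 1.
- by constructor 2.
- by constructor 3.
move: u; rewrite /= !inE !negb_or -!val_eqE /=.
by case: i j k c => [[|[|[|?]]] ?] [[|[|[|?]]] ?] [[|[|[|?]]] ?] [[|[|[|?]]] ?].
Qed.

Section Gem.
Variables (X : eqType).
Implicit Types r : 'I_3 -> X -> X.

Lemma aliveE r c x : is_gem r -> alive r x = (r c x != x).
Proof.
by move=> [_ h]; rewrite /alive; congr negb; apply/eqP/eqP; exact: h.
Qed.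

Lemma aliveP r c x : is_gem r -> alive r x -> r c x <> x.
Proof. by move=> h; rewrite (aliveE c x h) => /eqP. Qed.

Lemma alive_step r c x : is_gem r -> alive r (r c x) = alive r x.
Proof.
by move=> h; rewrite !(aliveE c _ h) gemK // eq_sym.
Qed.

Lemma excise_gem r x y : is_gem r -> alive r x -> alive r y -> x != y ->
  is_gem (excise r x y).
Proof.
move=> h ax ay xy; split=> [c|c d u].
  by apply: cutK => //; [exact: gemK|rewrite -aliveE|rewrite -aliveE].
rewrite /excise; case: (boolP (u \in [:: x; y])) => [hu|hu].
  by rewrite !cut_in.
have e c' := cut_fix (gemK h c') xy hu.
by move/eqP; rewrite e => /eqP /(gem_fix h d) /eqP; rewrite -e => /eqP.
Qed.

Lemma alive_excise r x y u : is_gem r -> x != y ->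
  alive (excise r x y) u = alive r u && (u \notin [:: x; y]).
Proof.
move=> h xy; rewrite /alive /excise.
case: (boolP (u \in [:: x; y])) => hu; first by rewrite cut_in // eqxx andbF.
by rewrite andbT cut_fix //; exact: gemK.
Qed.

Lemma exciseC r x y : excise r x y = excise r y x.
Proof. by apply: funext => c; rewrite /excise cutC. Qed.

Lemma excise_comm r x y x' y' : is_gem r -> uniq [:: x; y; x'; y'] ->
  alive r x -> alive r y -> alive r x' -> alive r y' ->
  excise (excise r x y) x' y' = excise (excise r x' y') x y.
Proof.
move=> h u ? ? ? ?; apply: funext => c; rewrite /excise.
by apply: cut_comm; rewrite -?aliveE //; exact: gemK.
Qed.

Lemma excise_out r x y c u : u \notin [:: x; y] -> r c u \notin [:: x; y] ->
  excise r x y c u = r c u.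
Proof. exact: cut_out. Qed.

Lemma excise_through r x y c u : u \notin [:: x; y] -> r c u = x ->
  excise r x y c u = r c y.
Proof. exact: cut_through. Qed.

Definition rungs r i j k x :=
  [:: x; r i x; r j x; r j (r i x); r k x; r k (r i x)].

(** The four inequalities of [ladder] imply all fifteen: the others follow from the two squares,
    involutivity and the absence of fixed points. *)
Lemma rungs_uniq r i j k x : is_gem r -> ladder r i j k x ->
  uniq (rungs r i j k x).
Proof.
move=> h [cu al sj sk ij ik jk jik]; rewrite /= !inE !negb_or.
have K c z := gemK h c z; have F c : r c x <> x := aliveP h al.
have al' := al; rewrite -(alive_step i _ h) in al'.
have F' c : r c (r i x) <> r i x := aliveP h al'.
move: (F i) (F j) (F k) (F' i) (F' j) (F' k).
move: (K i x) (K j x) (K k x) (K j (r i x)) (K k (r i x)).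
move: (K i (r j x)) (K i (r k x)).
by move=> *; repeat (apply/andP; split=> //); apply/eqP; congruence.
Qed.

Lemma ladder_swap r i j k x : is_gem r -> ladder r i j k x -> ladder r i k j x.
Proof.
move=> h [cu al sj sk ij ik jk jik]; split=> //; last 2 first.
- by move=> e; apply: jk.
- move=> e; apply: jik; rewrite -(gemK h i (r j x)) sj -e sk //.
by uniq_cases cu; uniq_solve.
Qed.

Lemma ladder_flip r i j k x : is_gem r -> ladder r i j k x ->
  ladder r i j k (r i x).
Proof.
move=> h [cu al sj sk ij ik jk jik]; have K c z := gemK h c z.
move: (K i x) (K i (r j x)) (K i (r k x)) (K k (r i x)) (K j (r i x)).
by move=> *; split; rewrite ?alive_step //; congruence.
Qed.

(** Starting from the other end of the middle rung only exchanges the two excised pairs. *)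
Lemma contract_flip r i j k x : is_gem r -> ladder r i j k x ->
  contract r i j (r i x) = contract r i j x.
Proof.
move=> h l; rewrite /contract gemK //; have al := ladder_alive l.
rewrite excise_comm ?alive_step //.
have H := rungs_uniq h l; uniq_cases H; uniq_solve.
Qed.
End Gem.

Lemma giso_refl (X : eqType) (r : 'I_3 -> X -> X) : giso r r.
Proof. by exists 1%g, id, id; split=> // c x _; rewrite perm1. Qed.

Lemma giso_by_sym (X Y : eqType) s f g (r : 'I_3 -> X -> X) (r' : 'I_3 -> Y ->
  Y) :
  is_gem r -> is_gem r' -> giso_by s f g r r' -> giso_by s^-1%g g f r' r.
Proof.
move=> h h' [af ag fK gK cm]; split=> // c y ay.
have := cm (s^-1%g c) (g y) (ag _ ay); rewrite permKV gK // => <-.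
by rewrite fK // alive_step // ag.
Qed.

Lemma giso_sym (X Y : eqType) (r : 'I_3 -> X -> X) (r' : 'I_3 -> Y -> Y) :
  is_gem r -> is_gem r' -> giso r r' -> giso r' r.
Proof.
move=> h h' [s [f [g iso]]]; exists s^-1%g, g, f; exact: giso_by_sym iso.
Qed.

Lemma giso_trans (X Y Z : eqType) (r : 'I_3 -> X -> X) (r' : 'I_3 -> Y -> Y)
  (r'' : 'I_3 -> Z -> Z) : giso r r' -> giso r' r'' -> giso r r''.
Proof.
move=> [s [f [g [af ag fK gK cm]]]] [s' [f' [g' [af' ag' fK' gK' cm']]]].
exists (s * s')%g, (f' \o f), (g \o g'); split=>
  /= [x /af /af' //|y /ag' /ag //|x ax|y ay|c x ax].
- by rewrite fK' ?fK // af.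
- by rewrite gK ?gK' // ag'.
- by rewrite cm // cm' ?af // permM.
Qed.

Lemma giso_excise (X Y : eqType) s f g (r : 'I_3 -> X -> X) (r' : 'I_3 -> Y ->
  Y) x y :
  is_gem r -> is_gem r' -> giso_by s f g r r' ->
  alive r x -> alive r y -> x != y ->
  giso_by s f g (excise r x y) (excise r' (f x) (f y)).
Proof.
move=> h h' [af ag fK gK cm] ax ay xy.
have fE u v : alive r u -> alive r v -> (f u == f v) = (u == v).
  by move=> au av; apply/eqP/eqP => [e|-> //]; rewrite -(fK u) // e fK.
have xy' : f x != f y by rewrite fE.
split=> [u|u|u|u|c u]; rewrite !alive_excise ?inE // => /andP[au /norP[ux uy]].
- by rewrite !fE // af // negb_or ux.
- rewrite ag // -(fE _ x) ?ag // -(fE _ y) ?ag // gK //= negb_or ux //.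
- exact: fK.
- exact: gK.
rewrite /excise /cut !fE // (negbTE ux) (negbTE uy) /=.
by rewrite -!cm // !fE ?alive_step //; do !case: ifP.
Qed.

Section Sim.
Variables (X Y : eqType).
Implicit Types (r : 'I_3 -> X -> X).

Lemma step_gem r r1 : is_gem r -> step r r1 -> is_gem r1.
Proof.
move=> h [i j x [ij al e]|i j k x l].
  by apply: excise_gem; rewrite ?alive_step // eq_sym -aliveE.
have al := ladder_alive l; have H := rungs_uniq h l; uniq_cases H.
have xp : x != r j x by apply/eqP.
apply: excise_gem; first by apply: excise_gem; rewrite ?alive_step.
- by rewrite alive_excise // !inE alive_step // al /= negb_or; uniq_solve.
- by rewrite alive_excise // !inE !alive_step // al /= negb_or; uniq_solve.
by apply/eqP.
Qed.

(** Dipoles and ladders are expressed through the involutions on alive faces, so a move is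
    transported along [f], its colours along [s]. *)
Lemma step_giso r r1 (r' : 'I_3 -> Y -> Y) : is_gem r -> is_gem r' ->
  giso r r' -> step r r1 ->
  exists2 r1', step r' r1' & giso r1 r1'.
Proof.
move=> h h' [s [f [g iso]]] st; have [af ag fK gK cm] := iso.
have fI u v : alive r u -> alive r v -> f u = f v -> u = v.
  by move=> au av e; rewrite -(fK u) // e fK.
case: st => [i j x [ij al e]|i j k x l].
  exists (excise r' (f x) (r' (s i) (f x))).
    apply: (@step_dipole _ _ _ (s j)); split; rewrite ?af -?cm ?e //.
    by rewrite (inj_eq perm_inj).
  exists s, f, g; rewrite -cm //; apply: giso_excise; rewrite ?alive_step //.
  by rewrite eq_sym -aliveE.
have al := ladder_alive l; have H := rungs_uniq h l; uniq_cases H.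
have xp : x != r j x by apply/eqP.
exists (contract r' (s i) (s j) (f x)).
  apply: (@step_ladder _ _ _ _ (s k)).
  have [cu _ sj sk ij ik jk jik] := l.
  split; rewrite ?af -?cm ?alive_step ?sj ?sk //; last 4 first.
  - by move/fI; rewrite ?alive_step //; auto.
  - by move/fI; rewrite ?alive_step //; auto.
  - by move/fI; rewrite ?alive_step //; auto.
  - by move/fI; rewrite ?alive_step //; auto.
  by rewrite -(map_inj_uniq (@perm_inj _ s)) in cu.
exists s, f, g; rewrite /contract -!cm ?alive_step //.
apply: giso_excise.
- by apply: excise_gem; rewrite ?alive_step.
- apply: excise_gem; rewrite ?af ?alive_step //; apply/eqP => /fI.
  by rewrite ?alive_step //; auto.
- by apply: giso_excise; rewrite ?alive_step.
- by rewrite alive_excise // !inE alive_step // al /= negb_or; uniq_solve.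
- by rewrite alive_excise // !inE !alive_step // al /= negb_or; uniq_solve.
by apply/eqP.
Qed.
End Sim.

Lemma steps_gem (X : eqType) (r r1 : 'I_3 -> X -> X) : is_gem r ->
  steps r r1 -> is_gem r1.
Proof. by move=> h st; elim: st h => // {r1}r r1 r2 st _ IH /step_gem /(_ st).
  Qed.

Lemma steps_giso (X Y : eqType) (r r1 : 'I_3 -> X -> X) (r' : 'I_3 -> Y -> Y) :
  is_gem r -> is_gem r' -> giso r r' -> steps r r1 ->
  exists2 r1', steps r' r1' & giso r1 r1'.
Proof.
move=> h h' iso st; elim: st r' h h' iso =>
  [{}r|{}r {}r1 r2 st _ IH] r' h h' iso.
  by exists r' => //; exact: steps_refl.
have [r1' st' iso'] := step_giso h h' iso st.
have [r2' st2 iso2] := IH r1' (step_gem h st) (step_gem h' st') iso'.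
by exists r2' => //; apply: steps_step st' st2.
Qed.

(** * Local confluence: the critical pairs of dipoles and ladders *)

Definition joinable (X : eqType) (r1 r2 : 'I_3 -> X -> X) :=
  exists q1 q2, [/\ steps r1 q1, steps r2 q2 & giso q1 q2].

Section Confluence.
Variable (X : eqType).
Implicit Types r : 'I_3 -> X -> X.

Lemma joinable_sym r1 r2 : is_gem r1 -> is_gem r2 -> joinable r1 r2 ->
  joinable r2 r1.
Proof.
move=> h1 h2 [q1 [q2 [s1 s2 iso]]]; exists q2, q1; split=> //.
by apply: giso_sym iso; [exact: steps_gem s1|exact: steps_gem s2].
Qed.

Lemma joinable_giso r1 r1' r2 : is_gem r1 -> is_gem r1' -> giso r1 r1' ->
  joinable r1' r2 -> joinable r1 r2.
Proof.
move=> h h' iso [q1 [q2 [s1 s2 iso2]]].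
have [q s1' iso1] := steps_giso h' h (giso_sym h h' iso) s1.
exists q, q2; split=> //; apply: giso_trans iso2; apply: giso_sym iso1.
  exact: steps_gem s1.
exact: steps_gem s1'.
Qed.

Lemma giso_joinable r1 r2 : giso r1 r2 -> joinable r1 r2.
Proof. by exists r1, r2; split=> //; exact: steps_refl. Qed.

Lemma join_step r1 r2 q : step r1 q -> step r2 q -> joinable r1 r2.
Proof.
move=> s1 s2; exists q, q; split; last exact: giso_refl.
  by apply: steps_step s1 (steps_refl _).
by apply: steps_step s2 (steps_refl _).
Qed.

Lemma contract_gem r i j k x : is_gem r -> ladder r i j k x ->
  is_gem (contract r i j x).
Proof. by move=> h l; apply: step_gem h (step_ladder l). Qed.

(* The two choices leave a different rung of the ladder; the isomorphism *)
(* exchanges the two outer rungs.                                        *)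
Lemma contract_giso r i j k x : is_gem r -> ladder r i j k x ->
  giso (contract r i j x) (contract r i k x).
Proof.
move=> h l; have al := ladder_alive l; have H := rungs_uniq h l.
have [cu _ sj sk _ _ _ _] := l.
set y := r i x in sj sk *.
set p := r j x; set q := r j y; set a := r k x; set b := r k y.
pose t u := if u == p then a else if u == a then p else
            if u == q then b else if u == b then q else u.
have K c z := gemK h c z.
have Hal c z : alive r z -> r c z <> z by move=> az; exact: aliveP h az.
have aly : alive r y by rewrite alive_step.
have H' : uniq [:: x; y; p; q; a; b] := H.
uniq_cases H'.
have tK u : t (t u) = u by rewrite /t; case_eqs.
have D z (u v u' v' : X) : alive r u -> alive r v -> alive r u' -> alive r v' ->
   uniq [:: u; v; u'; v'] ->
  alive (excise (excise r u v) u' v') z = alive r z && (z \notin [:: u; v; u';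
    v']).
  move=> au av au' av' Hu; uniq_cases Hu.
  have uv : u != v by apply/eqP.
  rewrite alive_excise; last by apply/eqP.
    by rewrite alive_excise // !inE !negb_or -!andbA.
  exact: excise_gem.
have alj z : alive (contract r i j x) z = alive r z && (z \notin [:: x; p; y;
  q]).
  by rewrite D // ?alive_step //; rewrite -/y -?/p -?/q -?/a -?/b; uniq_solve.
have alk z : alive (contract r i k x) z = alive r z && (z \notin [:: x; a; y;
  b]).
  by rewrite D // ?alive_step //; rewrite -/y -?/p -?/q -?/a -?/b; uniq_solve.
have alt z : alive r (t z) = alive r z.
  by rewrite /t; do 4! (case: (z =P _) => [->|_]; first by rewrite ?alive_step).
exists 1%g, t, t; split=> // [z|z|c z]; rewrite ?alj ?alk ?alt => /andP[az];
  rewrite ?az /=.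
- by move=> H'; uniq_cases H'; rewrite /t; case_eqs; uniq_solve.
- by move=> H'; uniq_cases H'; rewrite /t; case_eqs; uniq_solve.
rewrite perm1 => H'; uniq_cases H'.
have xi : r i x = y by []. have yi : r i y = x by exact: K.
have pi : r i p = q by []. have ai : r i a = b by [].
have qi : r i q = p by rewrite -pi K. have bi : r i b = a by rewrite -ai K.
have [xj yj pj qj] : [/\ r j x = p, r j y = q, r j p = x & r j q = y].
  by rewrite /p /q !K.
have [xk yk ak bk] : [/\ r k x = a, r k y = b, r k a = x & r k b = y].
  by rewrite /a /b !K.
have [ala alb alp alq] : [/\ alive r a, alive r b, alive r p & alive r q].
  by rewrite !alive_step.
move: (Hal c z az) (Hal c a ala) (Hal c b alb) (Hal c p alp) (Hal c q alq).
move: (K c z) (K c a) (K c b) (K c p) (K c q).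
case: (colors3 cu c) => -> *;
  rewrite /contract -/y -/p -/q -/a -/b /excise /cut /t.
- by case_eqs.
- by case_eqs.
- by case_eqs.
Qed.

Lemma contract_out r i j x c w : w \notin [:: x; r j x; r i x; r j (r i x)] ->
  r c w \notin [:: x; r j x; r i x; r j (r i x)] ->
  contract r i j x c w = r c w.
Proof.
rewrite !inE !negb_or => /and4P[? ? ? ?] /and4P[? ? ? ?].
have e : excise r x (r j x) c w = r c w by rewrite excise_out // !inE negb_or;
  apply/andP.
by rewrite /contract excise_out ?e // !inE negb_or; apply/andP.
Qed.

Lemma excise_rung r (s : seq X) u v c w : u \notin s -> v \notin s ->
  w \in s -> r c w \in s -> excise r u v c w = r c w.
Proof.
move=> hu hv hw hw'; apply: excise_out; rewrite !inE negb_or.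
  by apply/andP; split; [apply: contraNneq hu|apply: contraNneq hv] => <-.
by apply/andP; split; [apply: contraNneq hu|apply: contraNneq hv] => <-.
Qed.

Lemma rungs_excise r i j k x u v :
  u \notin rungs r i j k x -> v \notin rungs r i j k x ->
  rungs (excise r u v) i j k x = rungs r i j k x.
Proof.
move=> hu hv; have E := excise_rung hu hv.
rewrite {1}/rungs; have -> : excise r u v i x = r i x by apply: E;
  rewrite !inE ?eqxx ?orbT.
by rewrite !E // !inE ?eqxx ?orbT.
Qed.

Lemma ladder_excise r i j k x u v : is_gem r -> ladder r i j k x -> u != v ->
  u \notin rungs r i j k x -> v \notin rungs r i j k x ->
  ladder (excise r u v) i j k x.
Proof.
move=> h [cu al sj sk ij ik jk jik] uv hu hv.
have E c w := excise_rung (r := r) (c := c) (w := w) hu hv.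
have Ei : excise r u v i x = r i x by apply: E; rewrite !inE ?eqxx ?orbT.
have Ej : excise r u v j x = r j x by apply: E; rewrite !inE ?eqxx ?orbT.
have Ek : excise r u v k x = r k x by apply: E; rewrite !inE ?eqxx ?orbT.
have Eij : excise r u v j (r i x) = r j (r i x) by apply: E;
  rewrite !inE ?eqxx ?orbT.
have Eik : excise r u v k (r i x) = r k (r i x) by apply: E;
  rewrite !inE ?eqxx ?orbT.
split; rewrite ?Ei ?Ej ?Ek ?Eij ?Eik //.
- rewrite alive_excise // al !inE negb_or /=.
  by apply/andP; split; [apply: contraNneq hu|apply: contraNneq hv] => <-;
    rewrite inE eqxx.
- by rewrite E ?sj // !inE ?eqxx ?orbT.
- by rewrite E ?sk // !inE ?eqxx ?orbT.
Qed.

Lemma contract_excise r i j k x u v : is_gem r -> ladder r i j k x ->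
  alive r u -> alive r v -> u != v ->
  u \notin rungs r i j k x -> v \notin rungs r i j k x ->
  contract (excise r u v) i j x = excise (contract r i j x) u v.
Proof.
move=> h l au av uv hu hv; have al := ladder_alive l.
have E c w := excise_rung (r := r) (c := c) (w := w) hu hv.
rewrite /contract (E i x) ?(E j x) ?(E j (r i x)) ?inE ?eqxx ?orbT //.
have := rungs_uniq h l; move: hu hv; rewrite !inE !negb_or.
move=> /and5P[/eqP ? /eqP ? /eqP ? /eqP ? _] /and5P[/eqP ? /eqP ? /eqP ? /eqP ?
  _] H.
uniq_cases H; move/eqP: uv => uv.
rewrite (excise_comm h) ?alive_step //; last by uniq_solve.
apply: excise_comm; first by apply: excise_gem; rewrite ?alive_step //;
  apply/eqP.
- by uniq_solve.
all: rewrite alive_excise ?alive_step ?au ?av ?al ?inE //; by uniq_solve.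
Qed.

(** The first contraction consists of two excisions that do not touch the rungs of the second
    ladder; [contract_excise] moves the second contraction past each of them. *)
Lemma contract_comm r i j k x i' j' k' x' : is_gem r ->
  ladder r i j k x -> ladder r i' j' k' x' ->
  (forall w, w \in rungs r i j k x -> w \notin rungs r i' j' k' x') ->
  ladder (contract r i j x) i' j' k' x' /\
  contract (contract r i j x) i' j' x' = contract (contract r i' j' x') i j x.
Proof.
move=> h l l' dis; have al := ladder_alive l.
have [hx [hy [hp hq]]] : x \notin rungs r i' j' k' x' /\
  r i x \notin rungs r i' j' k' x' /\
  r j x \notin rungs r i' j' k' x' /\ r j (r i x) \notin rungs r i' j' k' x'.
  by do !split; apply: dis; rewrite !inE eqxx ?orbT.
have U := rungs_uniq h l; uniq_cases U.
have xp : x != r j x by apply/eqP.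
have yq : r i x != r j (r i x) by apply/eqP.
have h1 : is_gem (excise r x (r j x)) by apply: excise_gem; rewrite ?alive_step.
have l1 := ladder_excise h l' xp hx hp.
have R1 := rungs_excise hx hp.
rewrite {1}/contract; split; first by apply: ladder_excise; rewrite ?R1.
rewrite /contract -!/(contract _ i' j' x') (contract_excise (k :=
  k') h1 l1) ?R1 //.
- rewrite (contract_excise (k := k') h l') ?alive_step //.
  have E c w : w \in rungs r i j k x -> r c w \in rungs r i j k x ->
      contract r i' j' x' c w = r c w.
    move=> /dis w1 /dis w2; apply: contract_out.
      by move: w1; rewrite !inE !negb_or => /and5P[-> -> -> -> _].
    by move: w2; rewrite !inE !negb_or => /and5P[-> -> -> -> _].
  by rewrite (E i x) ?(E j x) ?(E j (r i x)) ?inE ?eqxx ?orbT.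
- by rewrite alive_excise // !alive_step // al !inE; uniq_solve.
- by rewrite alive_excise // !alive_step // al !inE; uniq_solve.
Qed.

Lemma dipole_flip r i j x : is_gem r -> dipole r i j x -> dipole r i j (r i x).
Proof.
by move=> h [ij al e]; split; rewrite ?alive_step // gemK // e gemK.
Qed.

Lemma dipole_excise r i j x u v : is_gem r -> dipole r i j x -> u != v ->
  u \notin [:: x; r i x] -> v \notin [:: x; r i x] ->
  dipole (excise r u v) i j x /\ excise r u v i x = r i x.
Proof.
move=> h [ij al e] uv hu hv; have E c := excise_rung (r := r) (c := c) (w :=
  x) hu hv.
rewrite /dipole !E ?inE ?eqxx ?orbT //; last by rewrite -e eqxx orbT.
split; split=> //; rewrite alive_excise // al !inE negb_or /=.
by apply/andP; split; [apply: contraNneq hu|apply: contraNneq hv] => <-;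
  rewrite inE eqxx.
Qed.

Lemma third_color (i j : 'I_3) : i != j -> exists k, uniq [:: i; j; k].
Proof.
move=> ij; exists (inord (3 - i - j)); move: ij;
  rewrite /= !inE !negb_or -!val_eqE /=.
by case: i j => [[|[|[|?]]] ?] [[|[|[|?]]] ?] //=; rewrite inordK.
Qed.

(** Two pairs among three colours share a colour, so dipoles that meet in a face consist of the same
    two faces. Otherwise they are disjoint and commute. *)
Lemma dipole_dipole r i j x i' j' x' : is_gem r ->
  dipole r i j x -> dipole r i' j' x' ->
  joinable (excise r x (r i x)) (excise r x' (r i' x')).
Proof.
move=> h d d'; have [ij al e] := d; have [ij' al' e'] := d'.
have xy : x != r i x by rewrite eq_sym -aliveE.
have xy' : x' != r i' x' by rewrite eq_sym -aliveE.
have same z : dipole r i' j' z -> dipole r i j z -> r i z = r i' z.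
  move=> [nij az ez] [nij' _ ez']; have [k cu] := third_color nij'.
  by case: (colors3 cu i') nij ez => ->; case: (colors3 cu j') => -> //;
    rewrite ?eqxx // => _; congruence.
have main z : dipole r i j z -> z \in [:: x'; r i' x'] ->
    excise r z (r i z) = excise r x' (r i' x').
  move=> dz; rewrite !inE => /orP[] /eqP ex.
    by rewrite ex in dz *; rewrite (same _ d' dz).
  have d'' := dipole_flip h d'; rewrite -ex in d''.
  by rewrite (same _ d'' dz) ex gemK // exciseC.
case: (boolP (x \in [:: x'; r i' x'])) => hx.
  by rewrite (main _ d hx); exact/giso_joinable/giso_refl.
case: (boolP (r i x \in [:: x'; r i' x'])) => hy.
  by rewrite -(main _ (dipole_flip h d) hy) gemK // exciseC;
    exact/giso_joinable/giso_refl.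
have [d1 e1] := dipole_excise h d' xy hx hy.
move: hx hy; rewrite !inE !negb_or => /andP[hx1 hx2] /andP[hy1 hy2].
have hx' : x' \notin [:: x; r i x] by rewrite !inE negb_or !(eq_sym x') hx1 hy1.
have hy' : r i' x' \notin [:: x;
  r i x] by rewrite !inE negb_or !(eq_sym (r i' x')) hx2 hy2.
have [d2 e2] := dipole_excise h d xy' hx' hy'.
apply: join_step (step_dipole d1) _; rewrite e1 excise_comm ?alive_step //.
  by rewrite -e2; exact: step_dipole d2.
by rewrite /= !inE !negb_or xy hx1 hx2 hy1 hy2 xy'.
Qed.

Lemma ladder_no_dipole r i j k x i' j' :
  ladder r i j k x -> ~ dipole r i' j' x.
Proof.
move=> [cu al sj sk ij ik jk jik] [nij _].
by case: (colors3 cu i') nij => ->; case: (colors3 cu j') => -> //;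
  rewrite ?eqxx // => _; congruence.
Qed.

(** The [j]-neighbour of [r j x] is [x], which differs from its [i]- and [k]-neighbours; so the
    dipole uses the colours [i] and [k] and is the outer rung itself. *)
Lemma dipole_rung r i j k x i' j' : is_gem r -> ladder r i j k x ->
  dipole r i' j' (r j x) ->
  r i' (r j x) = r j (r i x) /\ r k (r j x) = r j (r i x).
Proof.
move=> h l [nij _]; have [cu al sj sk ij ik jk jik] := l.
have K c z := gemK h c z.
have e1 : r i (r j x) <> r j (r j x).
  by rewrite sj K => e; apply: ij; rewrite -[in LHS]e K.
have e2 : r k (r j x) <> r j (r j x).
  by rewrite K => e; apply: jk; rewrite -{2}e K.
by case: (colors3 cu i') nij => ->; case: (colors3 cu j') => -> //;
  rewrite ?eqxx // => _ e; split; congruence.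
Qed.

(** [contract] pairs the four faces along colour [j], the two cancellations pair them along the
    rungs. Removing the outer rung turns the middle one into a dipole, and both pairings glue the
    same neighbours. *)
Lemma dipole_rung_contract r i j k x : is_gem r -> ladder r i j k x ->
  r k (r j x) = r j (r i x) ->
  let r1 := excise r (r j x) (r j (r i x)) in
  dipole r1 i j x /\ excise r1 x (r1 i x) = contract r i j x.
Proof.
move=> h l e r1; have [cu al sj sk _ _ _ _] := l.
have U := rungs_uniq h l; uniq_cases U.
have K c z := gemK h c z.
have E : r1 i x = r i x by apply: excise_out; rewrite !inE negb_or; apply/andP;
  split; apply/eqP; congruence.
have Ej : r1 j x = r i x.
  rewrite /r1 excise_through ?K // !inE negb_or; apply/andP; split; apply/eqP;
    congruence.
split.
  split; rewrite ?E ?Ej //; first by case/andP: cu; rewrite inE negb_or =>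
    /andP[].
  rewrite alive_excise // ?inE ?al ?negb_or; last by apply/eqP.
  by rewrite /=; apply/andP; split; apply/eqP; congruence.
rewrite E; apply: funext => c; apply: funext => z;
  rewrite /r1 /contract /excise.
move: (K i x) (K j x) (K j (r i x)) (K i (r j x)) (K k (r j x)) (K k x) (K k (r
  i x)).
move: (K c z).
case: (colors3 cu c) => -> *; rewrite /cut; by case_eqs.
Qed.

(** A dipole cannot contain an end of the middle rung. If it meets an outer rung, it is that rung,
    and one more cancellation reaches the contraction on that side. A dipole off the ladder commutes
    with it. *)
Lemma dipole_ladder r i j k x i' j' u : is_gem r ->
  dipole r i' j' u -> ladder r i j k x ->
  joinable (excise r u (r i' u)) (contract r i j x).
Proof.
move=> h d l; have [_ alu _] := d.
have al := ladder_alive l.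
have uv : u != r i' u by rewrite eq_sym -aliveE.
have over u1 j1 k1 x1 : dipole r i' j' u1 -> ladder r i j1 k1 x1 ->
  u1 = r j1 x1 ->
    joinable (excise r u1 (r i' u1)) (contract r i j1 x1).
  move=> d1 l1 e1; rewrite e1 in d1 *; have [-> e] := dipole_rung h l1 d1.
  have [d2 <-] := dipole_rung_contract h l1 e.
  set q := excise _ _ _ i x1.
  exists (excise (excise r (r j1 x1) (r j1 (r i x1))) x1 q).
  exists (excise (excise r (r j1 x1) (r j1 (r i x1))) x1 q).
  split; [|exact: steps_refl|exact: giso_refl].
  exact: steps_step (step_dipole d2) (steps_refl _).
have hit u1 : dipole r i' j' u1 -> u1 \in rungs r i j k x ->
    joinable (excise r u1 (r i' u1)) (contract r i j x).
  move=> d1; have l' := ladder_flip h l.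
  (* For a dipole on the [k] side, [contract_giso] replaces the contraction towards [j] by the one
     towards [k]. *)
  have sw x1 j1 : ladder r i k j x1 -> contract r i j x1 = j1 ->
    joinable (excise r u1 (r i' u1)) (contract r i k x1) ->
    joinable (excise r u1 (r i' u1)) j1.
    move=> l1 <- J; have l1' := ladder_swap h l1.
    have hh : is_gem (excise r u1 (r i' u1)) by apply: step_gem h (step_dipole
      d1).
    apply: joinable_sym => //; first exact: contract_gem l1'.
    apply: joinable_giso (contract_giso h l1') _.
    - exact: contract_gem l1'.
    - exact: contract_gem l1.
    by apply: joinable_sym => //; exact: contract_gem l1.
  rewrite !inE => /or4P[/eqP e|/eqP e|/eqP e|/or3P[/eqP e|/eqP e|/eqP e]].
  - by rewrite e in d1; have := ladder_no_dipole l d1.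
  - by rewrite e in d1; have := ladder_no_dipole l' d1.
  - exact: over d1 l e.
  - by rewrite -(contract_flip h l); exact: over d1 l' e.
  - exact: sw (ladder_swap h l) erefl (over _ _ _ _ d1 (ladder_swap h l) e).
  - apply: sw (ladder_swap h l') (contract_flip h l) _.
    exact: over d1 (ladder_swap h l') e.
case: (boolP (u \in rungs r i j k x)) => hu; first exact: hit.
case: (boolP (r i' u \in rungs r i j k x)) => hv.
  by rewrite exciseC -{2}(gemK h i' u); apply: hit => //; exact: dipole_flip.
apply: join_step (step_ladder (ladder_excise h l uv hu hv)) _.
rewrite (contract_excise h l) ?alive_step //.
have U := rungs_uniq h l; uniq_cases U.
have ne z w : z \in rungs r i j k x -> w \notin rungs r i j k x -> z != w.
  by move=> hz; apply: contraNneq => <-.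
have no z : z \in rungs r i j k x -> z \notin [:: u; r i' u].
  by move=> hz; rewrite !inE negb_or !ne.
have [hx hp hy hq] : [/\ x \notin [:: u; r i' u], r j x \notin [:: u; r i' u],
   r i x \notin [:: u; r i' u] & r j (r i x) \notin [:: u; r i' u]].
  by split; apply: no; rewrite !inE eqxx ?orbT.
have xp : x != r j x by apply/eqP.
have yq : r i x != r j (r i x) by apply/eqP.
have [d1 e1] := dipole_excise h d xp hx hp.
have h1 : is_gem (excise r x (r j x)) by apply: excise_gem; rewrite ?alive_step.
rewrite -e1 in hy hq; have [d2 e2] := dipole_excise h1 d1 yq hy hq.
by rewrite -e1 -e2; apply: step_dipole d2.
Qed.

(** Both ladders delete the rungs at [x] and at [r j x]. *)
Lemma ladder_adjacent r i j k x : is_gem r -> ladder r i j k x ->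
  ladder r i j k (r j x) -> contract r i j (r j x) = contract r i j x.
Proof.
move=> h l l'; rewrite /contract (ladder_sqj l) !(gemK h).
by rewrite [excise r _ x]exciseC exciseC.
Qed.

(** Overlapping ladders with the same three colours form one longer ladder, and up to isomorphism it
    does not matter which two neighbouring rungs of it are removed. *)
Lemma ladder_same_color r i j k x x' : is_gem r ->
  ladder r i j k x -> ladder r i j k x' ->
  x' \in rungs r i j k x \/ r j x = r k x' \/ r k x = r j x' ->
  giso (contract r i j x) (contract r i j x').
Proof.
move=> h.
have adj j1 k1 x1 x2 : ladder r i j1 k1 x1 -> ladder r i j1 k1 x2 ->
  x2 = r j1 x1 ->
    contract r i j1 x2 = contract r i j1 x1.
  by move=> l1 l2 e; rewrite e in l2 *; exact: ladder_adjacent l1 l2.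
have adjk x1 x2 : ladder r i j k x1 -> ladder r i j k x2 -> x2 = r k x1 ->
    giso (contract r i j x1) (contract r i j x2).
  move=> l1 l2 e; have [m1 m2] := (ladder_swap h l1, ladder_swap h l2).
  apply: giso_trans (contract_giso h l1) _.
  by rewrite -(adj _ _ _ _ m1 m2 e); exact: contract_giso m2.
have mid x1 x2 : ladder r i j k x1 -> ladder r i j k x2 -> r j x1 = r k x2 ->
    giso (contract r i j x1) (contract r i j x2).
  move=> l1 l2 e; have [cu al sj sk ij ik jk jik] := l1.
  have [_ al' sj' sk' ij' ik' jk' jik'] := l2; have K c z := gemK h c z.
  case: (x1 =P x2) => [-> |n1]; first exact: giso_refl.
  case: (x1 =P r i x2) => [-> |n2].
    by rewrite (contract_flip h l2); exact: giso_refl.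
  (* The shared outer rung is the middle of a third ladder, adjacent to both; the two cases just
     treated are those where it would degenerate. *)
  have lm : ladder r i j k (r j x1).
    move: (K i x1) (K j x1) (K k x1) (K i x2) (K j x2) (K k x2) => ? ? ? ? ? ?.
    move: (K j (r i x1)) (K k (r i x1)) (K j (r i x2)) (K k (r i x2)) =>
      ? ? ? ?.
    move: (K i (r j x1)) (K i (r k x1)) (K i (r j x2)) (K i (r k x2)) =>
      ? ? ? ?.
    by split; rewrite ?alive_step //; congruence.
  rewrite -(ladder_adjacent h l1 lm); apply: adjk => //.
  by rewrite e K.
move=> l l'; have m := ladder_flip h l; have m' := ladder_flip h l'.
case=> [|[e|e]]; last 2 first.
- exact: mid.
- apply: giso_sym; [exact: contract_gem l'|exact: contract_gem l|].
  exact: mid.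
rewrite !inE => /or4P[/eqP e|/eqP e|/eqP e|/or3P[/eqP e|/eqP e|/eqP e]].
- by rewrite e; exact: giso_refl.
- by rewrite e (contract_flip h l); exact: giso_refl.
- by rewrite (adj _ _ _ _ l l' e); exact: giso_refl.
- by rewrite (adj _ _ _ _ m l' e) (contract_flip h l); exact: giso_refl.
- exact: adjk.
- by rewrite -(contract_flip h l); exact: adjk.
Qed.

(** Here all three squares at [x] close up. The contraction deletes [x] and [r k x], so the
    [j]-edges at their other ends are glued, parallel to the [k]-edge already there. A BT-weld
    follows the same pattern. *)
Lemma ladder_corner_dipole r i j k x : is_gem r -> ladder r i k j x ->
  r j (r k x) = r k (r j x) ->
  dipole (contract r i k x) k j (r j x) /\
  contract r i k x k (r j x) = r k (r j x).
Proof.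
move=> h l sjk; have K c z := gemK h c z; have [cu al sk sj _ _ _ _] := l.
have U := rungs_uniq h l; uniq_cases U.
have xj := K j x; have xjk := K k (r j x); have xk := K k x; have xik :=
  K k (r i x).
have N z : z = r j x \/ z = r k (r j x) -> z \notin [:: x; r k x] /\
  z \notin [:: r i x; r k (r i x)].
  by case=> ->; split; uniq_solve.
have [[Np Np'] [Nz Nz']] := (N _ (or_introl erefl), N _ (or_intror erefl)).
have xa : x != r k x by apply/eqP.
have h1 : is_gem (excise r x (r k x)) by apply: excise_gem; rewrite ?alive_step.
have e1 : excise r x (r k x) k (r j x) = r k (r j x) by rewrite excise_out.
have e2 : excise r x (r k x) j (r j x) = r k (r j x) by rewrite excise_through.
have e3 : contract r i k x k (r j x) = r k (r j x) by rewrite /contract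
  excise_out ?e1.
have e4 : contract r i k x j (r j x) = r k (r j x) by rewrite /contract
  excise_out ?e2.
split=> //; split; rewrite ?e3 ?e4 //; first by uniq_cases cu; apply/eqP;
  congruence.
rewrite /contract alive_excise // ?alive_excise ?alive_step // ?al ?Np ?Np' //.
by apply/eqP.
Qed.

(* The ladders at x and x' end up excising the same three k-edges, which *)
(* start at x, r i x and r j x.                                          *)
Lemma ladder_corner r i j k x x' : is_gem r ->
  ladder r i k j x -> ladder r j k i x' -> x' = x \/ x' = r k x ->
  joinable (contract r i k x) (contract r j k x').
Proof.
move=> h l l' ex; have K c z := gemK h c z.
have [cu al sk sj ik ij kj kji] := l.
have sjk : r j (r k x) = r k (r j x).
  have sk' := ladder_sqj l'.
  by case: ex => e; rewrite e ?K // in sk'; rewrite sk' K.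
have -> : contract r j k x' = excise (excise r x (r k x)) (r j x) (r k (r j x)).
  case: ex => ->; rewrite /contract // K sjk K.
  by rewrite [excise r _ x]exciseC exciseC.
have U := rungs_uniq h l; uniq_cases U.
have xj := K j x; have xk := K k x; have xi := K i x.
have xjk := K k (r j x); have xik := K k (r i x).
have zp : r k (r j x) <> r j x by apply: aliveP; rewrite ?alive_step.
have P := ladder_corner_dipole h l sjk.
have D : uniq [:: x; r k x; r i x; r k (r i x); r j x;
  r k (r j x)] by uniq_solve.
rewrite /contract in P *; set a := r k x in sk sjk D P *; set y :=
  r i x in sk D P *.
set b := r k y in sk D P *; set p := r j x in sjk D P *; set z :=
  r k p in sjk D P *.
uniq_cases D; have xa : x != a by apply/eqP.
have h1 : is_gem (excise r x a) by apply: excise_gem; rewrite ?alive_step.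
have al1 w : alive r w -> w \notin [:: x; a] -> alive (excise r x a) w.
  by move=> aw hw; rewrite alive_excise // aw.
have [ay ab ap az] : [/\ alive r y, alive r b, alive r p &
  alive r z] by rewrite !alive_step.
have [yb pz] : y != b /\ p != z by split; apply/eqP.
have Y : dipole (excise (excise r x a) p z) k i y /\
  excise (excise r x a) p z k y = b.
  have e1 : excise r x a k y = b by rewrite excise_out // -/b; uniq_solve.
  have e2 : excise r x a i y = b.
    by rewrite excise_through ?xi // ?sk //; uniq_solve.
  have e3 : excise (excise r x a) p z k y = b by rewrite excise_out ?e1 //;
    uniq_solve.
  have e4 : excise (excise r x a) p z i y = b by rewrite excise_out ?e2 //;
    uniq_solve.
  split=> //; split; rewrite ?e3 ?e4 //.
    by uniq_cases cu; apply/eqP; congruence.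
  by rewrite alive_excise // alive_excise // ay; uniq_solve.
case: Y P => [Y eY] [P eP]; apply: join_step (step_dipole P) _; rewrite eP.
rewrite (excise_comm h1) //; first by rewrite -eY; exact: step_dipole Y.
1: by uniq_solve.
all: by apply: al1 => //; uniq_solve.
Qed.

Lemma rungsP r i j k x w : w \in rungs r i j k x ->
  exists2 x1, x1 = x \/ x1 = r i x & [\/ w = x1, w = r j x1 | w = r k x1].
Proof.
rewrite !inE => /or4P[/eqP e|/eqP e|/eqP e|/or3P[/eqP e|/eqP e|/eqP e]].
- by exists x; [left|constructor 1].
- by exists (r i x); [right|constructor 1].
- by exists x; [left|constructor 2].
- by exists (r i x); [right|constructor 2].
- by exists x; [left|constructor 3].
- by exists (r i x); [right|constructor 3].
Qed.

Lemma ladder_ladder_same r i j k x x' : is_gem r ->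
  ladder r i j k x -> ladder r i j k x' ->
  joinable (contract r i j x) (contract r i j x').
Proof.
move=> h l l'; have K c z := gemK h c z.
case: (boolP (has (mem (rungs r i j k x)) (rungs r i j k x'))) =>
  [/hasP[w w' ww]|/hasPn no].
  have [x1 e1 c1] := rungsP ww; have [x2 e2 c2] := rungsP w'.
  have l1 : ladder r i j k x1 by case: e1 => ->//; exact: ladder_flip.
  have l2 : ladder r i j k x2 by case: e2 => ->//; exact: ladder_flip.
  have -> : contract r i j x = contract r i j x1.
    by case: e1 => ->//; rewrite (contract_flip h l).
  have -> : contract r i j x' = contract r i j x2.
    by case: e2 => ->//; rewrite (contract_flip h l').
  apply: giso_joinable; apply: (ladder_same_color h l1 l2); rewrite !inE.
  case: c1 => ew; rewrite ew in c2; case: c2 => e.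
  - by left; rewrite e eqxx.
  - by left; rewrite e K eqxx ?orbT.
  - by left; rewrite e K eqxx ?orbT.
  - by left; rewrite -e eqxx ?orbT.
  - by left; rewrite -(K j x2) -e K eqxx.
  - by right; left.
  - by left; rewrite -e eqxx ?orbT.
  - by right; right.
  - by left; rewrite -(K k x2) -e K eqxx.
have no' w : w \in rungs r i j k x -> w \notin rungs r i j k x'.
  by move=> hw; apply/negP => /no; rewrite inE hw.
have [m e] := contract_comm h l l' no'.
have [m' _] := contract_comm h l' l no.
by apply: join_step (step_ladder m) _; rewrite e; exact: step_ladder m'.
Qed.

(** For each of the nine positions of a common face, the squares allow the middle rungs to be
    flipped until they start at the same face or at two ends of a [k]-edge, as [ladder_corner]
    requires. *)
Lemma ladder_ladder_diff r i j k x x' : is_gem r ->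
  ladder r i k j x -> ladder r j k i x' ->
  joinable (contract r i k x) (contract r j k x').
Proof.
move=> h l l'; have K c z := gemK h c z.
case: (boolP (has (mem (rungs r i k j x)) (rungs r j k i x'))) =>
  [/hasP[w w' ww]|/hasPn no].
  have [x1 e1 c1] := rungsP ww; have [x2 e2 c2] := rungsP w'.
  have l1 : ladder r i k j x1 by case: e1 => ->//; exact: ladder_flip.
  have l2 : ladder r j k i x2 by case: e2 => ->//; exact: ladder_flip.
  have -> : contract r i k x = contract r i k x1.
    by case: e1 => ->//; rewrite (contract_flip h l).
  have -> : contract r j k x' = contract r j k x2.
    by case: e2 => ->//; rewrite (contract_flip h l').
  have [m1 m2] := (ladder_flip h l1, ladder_flip h l2).
  have C y1 y2 : y1 = x1 \/ y1 = r i x1 -> y2 = x2 \/ y2 = r j x2 ->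
      y2 = y1 \/ y2 = r k y1 ->
        joinable (contract r i k x1) (contract r j k x2).
    move=> h1 h2 e.
    have -> : contract r i k x1 = contract r i k y1.
      by case: h1 => ->//; rewrite (contract_flip h l1).
    have -> : contract r j k x2 = contract r j k y2.
      by case: h2 => ->//; rewrite (contract_flip h l2).
    apply: ladder_corner => //; first by case: h1 => ->.
    by case: h2 => ->.
  have [cu _ sk sj _ _ _ _] := l1; have [_ _ sk' si' _ _ _ _] := l2.
  move: (K i x1) (K j x1) (K k x1) (K i x2) (K j x2) (K k x2) => ? ? ? ? ? ?.
  move: (K j (r i x1)) (K k (r i x1)) (K i (r j x2)) (K k (r j x2)) => ? ? ? ?.
  move: (K i (r k x1)) (K i (r j x1)) (K j (r i x2)) (K j (r k x2)) => ? ? ? ?.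
  case: c1 => ew; rewrite ew in c2; case: c2 => e.
  - by apply: (C x1 x2); [left|left|left].
  - by apply: (C x1 x2); [left|left|right; congruence].
  - by apply: (C (r i x1) x2); [right|left|left; congruence].
  - by apply: (C x1 x2); [left|left|right].
  - by apply: (C x1 x2); [left|left|left; congruence].
  - by apply: (C (r i x1) x2); [right|left|right; congruence].
  - by apply: (C x1 (r j x2)); [left|right|left; congruence].
  - by apply: (C x1 (r j x2)); [left|right|right; congruence].
  - by apply: (C (r i x1) (r j x2)); [right|right|left; congruence].
have no' w : w \in rungs r i k j x -> w \notin rungs r j k i x'.
  by move=> hw; apply/negP => /no; rewrite inE hw.
have [m e] := contract_comm h l l' no'.
have [m' _] := contract_comm h l' l no.
by apply: join_step (step_ladder m) _; rewrite e; exact: step_ladder m'.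
Qed.

Lemma joinable_swap r i j k x q : is_gem r -> ladder r i j k x ->
  joinable (contract r i k x) q -> joinable (contract r i j x) q.
Proof.
move=> h l; apply: joinable_giso (contract_giso h l).
  exact: contract_gem l.
exact: contract_gem (ladder_swap h l).
Qed.

(** By [contract_giso] the side of each contraction can be chosen: the same side if the rung colours
    agree, otherwise the third colour for both ladders. *)
Lemma ladder_ladder r i j k x i' j' k' x' : is_gem r ->
  ladder r i j k x -> ladder r i' j' k' x' ->
  joinable (contract r i j x) (contract r i' j' x').
Proof.
move=> h l l'; have g := contract_gem h l; have g' := contract_gem h l'.
have cu := ladder_colors l; have cu' := ladder_colors l'.
have [sl sl'] := (ladder_swap h l, ladder_swap h l').
have [sg sg'] := (contract_gem h sl, contract_gem h sl').
case: (colors3 cu i') => ei; case: (colors3 cu j') => ej;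
  case: (colors3 cu k') => ek;
  try by exfalso; subst; uniq_cases cu'.
all: subst i' j' k'.
- exact: ladder_ladder_same l l'.
- apply: joinable_swap l _ => //; exact: ladder_ladder_same sl l'.
- apply: joinable_swap l _ => //; apply: joinable_sym => //.
  apply: joinable_swap l' _ => //; apply: joinable_sym => //.
  exact: ladder_ladder_diff sl sl'.
- apply: joinable_swap l _ => //; exact: ladder_ladder_diff sl l'.
- apply: joinable_sym => //; apply: joinable_swap l' _ => //;
  apply: joinable_sym => //.
  exact: ladder_ladder_diff l sl'.
- exact: ladder_ladder_diff l l'.
Qed.

Lemma local_confluence r r1 r2 : is_gem r -> step r r1 -> step r r2 ->
  joinable r1 r2.
Proof.
move=> h s1 s2; have [g1 g2] := (step_gem h s1, step_gem h s2).
case: s1 g1 => [i j x d|i j k x l] g1; case: s2 g2 =>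
  [i' j' x' d'|i' j' k' x' l'] g2.
- exact: dipole_dipole d d'.
- exact: dipole_ladder d l'.
- by apply: joinable_sym => //; exact: dipole_ladder d' l.
- exact: ladder_ladder l l'.
Qed.
End Confluence.

(** * Uniqueness of normal forms *)

Definition irreducible (X : eqType) (r : 'I_3 -> X -> X) :=
  forall r1, ~ step r r1.

Definition reduces (X Y : eqType) (r : 'I_3 -> X -> X) (n : 'I_3 -> Y -> Y) :=
  exists2 q, steps r q & giso q n.

Lemma steps_trans (X : eqType) (r1 r2 r3 : 'I_3 -> X -> X) :
  steps r1 r2 -> steps r2 r3 -> steps r1 r3.
Proof. by elim=> // a b c st _ IH /IH; exact: steps_step. Qed.

Lemma steps_inv (X : eqType) (P : ('I_3 -> X -> X) -> Prop) (r r1 : 'I_3 ->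
  X -> X) :
  (forall a b, P a -> step a b -> P b) -> P r -> steps r r1 -> P r1.
Proof. by move=> hP + st; elim: st => // a b c st _ IH /hP /(_ st) /IH. Qed.

Lemma stepsP (X : eqType) (r q : 'I_3 -> X -> X) : steps r q ->
  r = q \/ exists2 r1, step r r1 & steps r1 q.
Proof. by case=> [{}r|{}r r1 {}q st sq]; [left|right; exists r1]. Qed.

Lemma reduces_giso (X Y Z : eqType) (r : 'I_3 -> X -> X) (r' : 'I_3 -> Y -> Y)
    (n : 'I_3 -> Z -> Z) :
  is_gem r -> is_gem r' -> giso r r' -> reduces r' n -> reduces r n.
Proof.
move=> h h' iso [q st qn].
have [q' st' iso'] := steps_giso h' h (giso_sym h h' iso) st.
exists q' => //; apply: giso_trans qn; apply: giso_sym iso';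
  first exact: steps_gem st.
exact: steps_gem st'.
Qed.

Lemma steps_reduces (X Y : eqType) (r r1 : 'I_3 -> X -> X) (n : 'I_3 -> Y ->
  Y) :
  steps r r1 -> reduces r1 n -> reduces r n.
Proof. by move=> st [q st' qn]; exists q => //; exact: steps_trans st st'. Qed.

Lemma step_alive (X : finType) (r r1 : 'I_3 -> X -> X) : is_gem r ->
  step r r1 ->
  (#|[set x | alive r1 x]| < #|[set x | alive r x]|)%N.
Proof.
move=> h st; apply/proper_card/properP.
have lt x y : alive r x -> alive r y -> x != y -> forall q,
    (forall u, alive q u -> alive (excise r x y) u) ->
    [set u | alive q u] \subset [set u | alive r u] /\
    exists2 u, u \in [set u | alive r u] & u \notin [set u | alive q u].
  move=> ax ay xy q sub; split.
    by apply/subsetP => u; rewrite !inE => /sub; rewrite alive_excise // =>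
      /andP[].
  exists x; rewrite !inE //; apply/negP => /sub.
  by rewrite alive_excise // !inE eqxx andbF.
case: st => [i j x [ij al e]|i j k x l].
  by apply: (lt x (r i x)); rewrite ?alive_step // eq_sym -aliveE.
have al := ladder_alive l; have H := rungs_uniq h l; uniq_cases H.
have xp : x != r j x by apply/eqP.
apply: (lt x (r j x)) => //; rewrite ?alive_step // => u.
have h1 : is_gem (excise r x (r j x)) by apply: excise_gem; rewrite ?alive_step.
by rewrite (alive_excise _ h1) => [/andP[]//|]; apply/eqP.
Qed.

(** Newman's argument for one fixed normal form, by induction on the number of alive faces. If the
    given reduction begins with [r2], then [r1] and [r2] are joinable, and the induction hypothesis
    applies to the reducts of [r2]. *)
Lemma step_reduces (X : finType) (Y : eqType) (r r1 : 'I_3 -> X -> X)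
    (n : 'I_3 -> Y -> Y) :
  is_gem r -> is_gem n -> irreducible n ->
  reduces r n -> step r r1 -> reduces r1 n.
Proof.
move=> h hn irr; have [m] := ubnP #|[set x | alive r x]|.
elim: m => // m IH in r r1 h * => le red st.
have down (q : 'I_3 -> X -> X) : is_gem q -> (#|[set x | alive q x]| < m)%N ->
  reduces q n ->
    forall q', steps q q' -> reduces q' n.
  move=> hq lt rq q' sq.
  pose P (q : 'I_3 -> X -> X) := [/\ is_gem q, #|[set x | alive q x]| < m &
    reduces q n].
  suff [] : P q' by [].
  apply: steps_inv sq => [a b [ha lta ra] sab|]; last by split.
  split; [exact: step_gem sab|exact: ltn_trans (step_alive ha sab) lta|].
  exact: IH ha lta ra sab.
case: red => q sq qn.
case: (stepsP sq) => [e|[r2 s2 s2']].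
  (* With no step made, [r] is isomorphic to [n], and the step to [r1] would be transported to the
     irreducible [n]. *)
  by rewrite -e in qn; have [n' /irr] := step_giso h hn qn st.
have [h1 h2] := (step_gem h st, step_gem h s2).
have [q1 [q2 [st1 st2 iso]]] := local_confluence h st s2.
apply: (steps_reduces st1); apply: (reduces_giso _ _ iso).
- exact: steps_gem st1.
- exact: steps_gem st2.
apply: (down r2) st2 => //; first by apply: leq_trans (step_alive h s2) _.
by exists q.
Qed.

Lemma reduces_steps (X : finType) (Y : eqType) (r r1 : 'I_3 -> X -> X)
    (n : 'I_3 -> Y -> Y) :
  is_gem r -> is_gem n -> irreducible n ->
  reduces r n -> steps r r1 -> reduces r1 n.
Proof.
move=> h hn irr red st; pose P (q : 'I_3 -> X -> X) := is_gem q /\ reduces q n.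
suff [] : P r1 by [].
apply: steps_inv st => [a b [ha ra] sab|]; last by split.
by split; [exact: step_gem sab|exact: step_reduces ra sab].
Qed.

Lemma reduces_irreducible (X Y : eqType) (r : 'I_3 -> X -> X) (n : 'I_3 -> Y ->
  Y) :
  irreducible r -> reduces r n -> giso r n.
Proof. by move=> irr [q /stepsP[<- //|[r1 /irr]]]. Qed.

(** * The gem of a balanced triangulation *)

(* Sets that are not faces are fixed, hence count as deleted. *)
Definition face_gem (T : complex) (k : T -> 'I_3) (c : 'I_3) (f : {set T}) :
    {set T} :=
  odflt f [pick g in faces T |
    [&& f \in faces T, g != f & [set v in f | k v != c] \subset g]].

Definition star (T : complex) (v : T) : {set {set T}} :=
  [set f in faces T | v \in f].

Section FaceGem.
Variables (T : complex) (k : T -> 'I_3).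
Hypotheses (sT : surface_complex T) (kT : proper_coloring k).
Implicit Types (f g : {set T}) (u v : T).

Lemma face_card f : f \in faces T -> #|f| = 3.
Proof. by case: sT => h _ _ _ _; exact: h. Qed.

Lemma face_cadj f u v : f \in faces T -> u \in f -> v \in f -> u != v ->
  cadj u v.
Proof. by move=> hf hu hv uv; rewrite /cadj uv; apply/existsP; exists f;
  rewrite hf hu. Qed.

Lemma face_inj f u v : f \in faces T -> u \in f -> v \in f -> k u = k v ->
  u = v.
Proof.
move=> hf hu hv e; apply/eqP/negPn/negP => uv.
by have := kT (face_cadj hf hu hv uv); rewrite e eqxx.
Qed.

Lemma face_color f c : f \in faces T -> exists2 v, v \in f & k v = c.
Proof.
move=> hf; have : c \in k @: f.
  suff -> : k @: f = [set: 'I_3] by rewrite inE.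
  apply/eqP; rewrite eqEcard subsetT cardsT card_ord card_in_imset ?face_card
    //.
  by move=> u v hu hv; exact: face_inj hf hu hv.
by case/imsetP => v hv ->; exists v.
Qed.

Lemma face_third f g g' u v : u != v -> f \in faces T -> g \in faces T ->
  g' \in faces T -> u \in f -> v \in f -> u \in g -> v \in g -> u \in g' ->
    v \in g' ->
  g != f -> g' != f -> g = g'.
Proof.
move=> uv hf hg hg' uf vf ug vg ug' vg' gf gf'; apply/eqP/negPn/negP => gg'.
have [_ _ /(_ u v (face_cadj hf uf vf uv)) card2 _ _] := sT.
have : [set f; g; g'] \subset [set f0 in faces T | (u \in f0) && (v \in f0)].
  by apply/subsetP => x; rewrite !inE -orbA => /or3P[] /eqP ->; apply/and3P.
move/subset_leq_card; rewrite card2 -setUA cardsU1 !inE negb_or eq_sym gf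
  eq_sym gf'.
by rewrite cards2 gg'.
Qed.

Lemma face_edge f c : f \in faces T -> exists u v,
  [/\ u != v, u \in f, v \in f, k u != c & k v != c].
Proof.
move=> hf; have [d cd] : exists d, c != d.
  by exists (if c == ord0 then ord_max else ord0); case: (c =P ord0) =>
    [->|/eqP].
have [e cu] := third_color cd; have [u uf ku] := face_color d hf.
have [v vf kv] := face_color e hf; uniq_cases cu.
by exists u, v; split=> //; apply/eqP; congruence.
Qed.

Lemma face_gem_eq c f g : f \in faces T -> g \in faces T -> g != f ->
  (forall v, v \in f -> k v != c -> v \in g) -> face_gem k c f = g.
Proof.
move=> hf hg gf sub; rewrite /face_gem.
have [u [v [uv uf vf ku kv]]] := face_edge c hf.
case: pickP => [g' /and4P[hg' _ gf' /subsetP sub']|/(_ g)] /=.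
  apply: (face_third uv hf) => //; rewrite ?sub //; apply: sub'; rewrite !inE.
    by rewrite uf.
  by rewrite vf.
rewrite hg hf gf /=; case/negP; apply/subsetP => w; rewrite !inE => /andP[];
  exact: sub.
Qed.

Lemma face_gemP c f : f \in faces T ->
  [/\ face_gem k c f \in faces T, face_gem k c f != f
    & forall v, v \in f -> k v != c -> v \in face_gem k c f].
Proof.
move=> hf; have [u [v [uv uf vf ku kv]]] := face_edge c hf.
have [_ _ /(_ u v (face_cadj hf uf vf uv)) card2 _ _] := sT.
have [g] : exists g, g \in [set f0 in faces T | (u \in f0) && (v \in f0)] :\ f.
  by apply/card_gt0P; move: card2; rewrite (cardsD1 f) !inE hf uf vf add1n =>
    -[->].
rewrite !inE => /and4P[gf hg ug vg].
have sub w : w \in f -> k w != c -> w \in g.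
  move=> wf kw.
  have cu : uniq [:: c; k u; k v].
    have kuv : k u <> k v by move=> e; case/eqP: uv; exact: face_inj hf uf vf e.
    by move/eqP: ku => ku; move/eqP: kv => kv; uniq_solve.
  case: (colors3 cu (k w)) => e; first by rewrite e eqxx in kw.
    by rewrite (face_inj hf wf uf e).
  by rewrite (face_inj hf wf vf e).
by rewrite (face_gem_eq hf hg gf sub).
Qed.

Lemma face_gem_out c f : f \notin faces T -> face_gem k c f = f.
Proof.
by move=> hf; rewrite /face_gem; case: pickP => //= g;
  rewrite (negbTE hf) /= andbF.
Qed.

Lemma face_gem_in c f : (face_gem k c f \in faces T) = (f \in faces T).
Proof.
case: (boolP (f \in faces T)) => hf; first by have [-> ] := face_gemP c hf.
by rewrite face_gem_out // (negbTE hf).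
Qed.

Lemma face_gemK c : involutive (face_gem k c).
Proof.
move=> f; case: (boolP (f \in faces T)) => hf; last by rewrite !face_gem_out.
have [hg gf sub] := face_gemP c hf; apply: face_gem_eq => //;
  first by rewrite eq_sym.
move=> v vg kv; have [w wf kw] := face_color (k v) hf.
rewrite -(face_inj hg (sub w wf _) vg kw) //.
by rewrite kw.
Qed.

Lemma alive_face f : alive (face_gem k) f = (f \in faces T).
Proof.
rewrite /alive; case: (boolP (f \in faces T)) => hf;
  last by rewrite face_gem_out ?eqxx.
by have [_ -> ] := face_gemP ord0 hf.
Qed.

Lemma face_gem_gem : is_gem (face_gem k).
Proof.
split; first exact: face_gemK.
move=> c d f e; apply: face_gem_out; apply/negP => hf.
by have [_ /eqP ] := face_gemP c hf.
Qed.

Lemma face_gem_mem c f v : f \in faces T -> k v != c ->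
  (v \in face_gem k c f) = (v \in f).
Proof.
move=> hf kv; apply/idP/idP => hv; last by have [_ _ ] := face_gemP c hf; exact.
have hg : face_gem k c f \in faces T by rewrite face_gem_in.
by have [_ _ /(_ v hv kv)] := face_gemP c hg; rewrite face_gemK.
Qed.

(** Two faces sharing two edges would share all three vertices: crossing colour [i] can lose only
    the vertex coloured [i], which crossing colour [j] keeps. *)
Lemma face_gem_neq i j f : f \in faces T -> i != j ->
  face_gem k i f <> face_gem k j f.
Proof.
move=> hf ij e; have [hg gf _] := face_gemP i hf; case/negP: gf.
rewrite eq_sym eqEcard !face_card // leqnn andbT; apply/subsetP => v vf.
have [kv|kv] := eqVneq (k v) i; last by rewrite face_gem_mem.
by rewrite e face_gem_mem // kv.
Qed.

Lemma face_edge_faces f g u v : f \in faces T -> g \in faces T -> u != v ->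
  u \in f -> v \in f -> u \in g -> v \in g ->
  exists d, [/\ d != k u, d != k v & g = f \/ g = face_gem k d f].
Proof.
move=> hf hg uv uf vf ug vg.
have kuv : k u != k v by apply: contraNneq uv => e; apply/eqP;
  exact: face_inj hf uf vf e.
have [d cu] := third_color kuv; exists d.
have [kud kvd] : k u != d /\ k v != d by uniq_cases cu; split; apply/eqP;
  congruence.
rewrite ![d == _]eq_sym; split=> //.
have [->|gf] := eqVneq g f; [by left|right].
have [hh hf' sub] := face_gemP d hf.
by apply: (face_third uv hf) => //; rewrite sub.
Qed.

(** Connectedness of the link, as an induction: the star of [v] is a single orbit of the two colours
    other than [k v]. *)
Lemma star_ind (P : {set T} -> Prop) v f0 : f0 \in faces T -> v \in f0 ->
  P f0 ->
  (forall f d, f \in faces T -> v \in f -> d != k v -> P f ->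
    P (face_gem k d f)) ->
  forall f, f \in faces T -> v \in f -> P f.
Proof.
move=> hf0 vf0 P0 Pstep f hf vf.
have other g : g \in faces T -> v \in g -> exists2 x, x \in g & x != v.
  move=> hg vg; have : 0 < #|g :\ v|.
    by have := face_card hg; rewrite (cardsD1 v) vg add1n => -[->].
  by case/card_gt0P => x; rewrite !inE => /andP[xv xg]; exists x.
(* The link is connected through its vertices while [P] speaks of faces, so the property carried
   along the path is that [P] holds on every face at the edge from [v] to [x]. *)
pose Q x := x != v /\ forall g, g \in faces T -> v \in g -> x \in g -> P g.
have prop g x : g \in faces T -> v \in g -> P g -> x \in g -> x != v -> Q x.
  move=> hg vg Pg xg xv; split=> // g' hg' vg' xg'.
  have [d [_ dv [->//|->]]] := face_edge_faces hg hg' xv xg vg xg' vg'.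
  exact: Pstep.
have [x xf0 xv] := other _ hf0 vf0; have [y yf yv] := other _ hf vf.
have [_ _ _ /(_ v x y) con _] := sT.
have {con} con : connect (fun x y => tri v x y \in faces T) x y.
  by apply: con; [apply: (face_cadj hf0)|apply: (face_cadj hf)];
    rewrite // eq_sym.
have Qx : Q x by exact: prop hf0 vf0 P0 xf0 xv.
suff [_ Qy] : Q y by exact: Qy.
case/connectP: con => p + ->; elim: p x Qx {xf0 xv} =>
  //= z p IH x Qx /andP[hz]; apply: IH.
have Pt : P (tri v x z) by apply: Qx.2 => //; rewrite !inE eqxx ?orbT.
apply: (prop _ _ hz _ Pt); rewrite ?inE ?eqxx ?orbT //.
apply: contraTneq hz => ->; apply/negP => /face_card.
by rewrite /tri setUC setUA setUid cards2; case: eqP.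
Qed.

(** A path in the graph from a vertex of [f0] to a vertex of [f] is followed, turning around each of
    its vertices by [star_ind]. *)
Lemma face_ind (P : {set T} -> Prop) f0 : f0 \in faces T -> P f0 ->
  (forall f d, f \in faces T -> P f -> P (face_gem k d f)) ->
  forall f, f \in faces T -> P f.
Proof.
move=> hf0 P0 Pstep f hf.
have [u uf0 _] := face_color ord0 hf0; have [v vf _] := face_color ord0 hf.
have [_ _ _ _ /(_ u v)/connectP[p + ev]] := sT.
elim: p u f0 hf0 uf0 P0 ev => [|w p IH] u f0 hf0 uf0 P0 /= ev.
  by move=> _; apply: (star_ind hf0 uf0) => //; [move=> g d hg _ _;
    exact: Pstep|rewrite -ev].
case/andP => /andP[_ /existsP[g /and3P[hg ug wg]]]; apply: (IH w g) => //.
by apply: (star_ind hf0 uf0) => // g' d hg' _ _; exact: Pstep.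
Qed.

(** The four corners of the [i]-[j] square are closed under both colours, so by [star_ind] they
    exhaust the star. *)
Lemma star_ladder i j l f : ladder (face_gem k) i j l f ->
  forall v, v \in f -> k v = l -> #|star v| <= 4.
Proof.
move=> [cu al sj _ _ _ _ _] v vf kv.
rewrite alive_face in al; have K := face_gemK.
pose s := [:: f; face_gem k i f; face_gem k j f; face_gem k j (face_gem k i f)].
apply: leq_trans (_ : #|s| <= _); last exact: card_size.
apply/subset_leq_card/subsetP => g; rewrite inE => /andP[hg vg].
apply: (star_ind (P := fun g => g \in s) al vf) => //;
  first by rewrite inE eqxx.
move=> h d hh vh; rewrite kv => dl.
case: (colors3 cu d) dl => -> dl; last by rewrite eqxx in dl.
  rewrite !inE => /or4P[] /eqP ->; rewrite ?K ?eqxx ?orbT //.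
    by rewrite sj eqxx ?orbT.
  by rewrite -sj K eqxx ?orbT.
by rewrite !inE => /or4P[] /eqP ->; rewrite ?K ?eqxx ?orbT.
Qed.

Lemma face_gem_irreducible :
  (forall f u v, f \in faces T -> u \in f -> v \in f -> u != v ->
     (4 < #|star u|) || (4 < #|star v|)) ->
  irreducible (face_gem k).
Proof.
move=> big r1 [i j x [ij al e]|i j l x lad].
  by apply: face_gem_neq ij e; rewrite -alive_face.
have hx : x \in faces T by rewrite -alive_face (ladder_alive lad).
have [u ux ku] := face_color j hx; have [v vx kv] := face_color l hx.
have uv : u != v.
  have cu := ladder_colors lad; uniq_cases cu; apply/eqP; congruence.
have := big x u v hx ux vx uv.
rewrite !ltnNge (star_ladder lad vx kv).
by rewrite (star_ladder (ladder_swap face_gem_gem lad) ux ku).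
Qed.
End FaceGem.

(** * Recovering a triangulation from its gem *)

Lemma coloring_unique (T : complex) (k k' : T -> 'I_3) : surface_complex T ->
  proper_coloring k -> proper_coloring k' ->
  exists s : {perm 'I_3}, forall v, k' v = s (k v).
Proof.
move=> sT kT kT'; have [f0 hf0|no] := pickP (mem (faces T)); last first.
  (* Without faces there are no vertices either, so any permutation will do. *)
  exists 1%g => v; have [_ /(_ v)[f hf _] _ _ _] := sT.
  by have := no f; rewrite /= hf.
have /fin_all_exists[w hw] : forall c : 'I_3, exists v, v \in f0 /\ k v = c.
  by move=> c; have [v] := face_color sT kT c hf0; exists v.
have inj : injective (k' \o w).
  move=> c d /= e; rewrite -(hw c).2 -(hw d).2.
  by rewrite (face_inj kT' hf0 (hw c).1 (hw d).1 e).
exists (perm inj) => v.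
(* Crossing an edge replaces one vertex, and its colour is forced by the two vertices that stay; so
   agreement spreads from [f0] to all faces. *)
pose P (f : {set T}) := forall v, v \in f -> k' v = perm inj (k v).
have [_ /(_ v)[f hf vf] _ _ _] := sT; suff /(_ v vf) : P f by [].
apply: (face_ind sT kT hf0) => // [u uf0|{f v hf vf}f d hf Pf v vg].
  rewrite permE /=; congr k'; have [h1 h2] := hw (k u).
  by apply: (face_inj kT hf0).
have hg : face_gem k d f \in faces T by rewrite face_gem_in.
have [kv|kv] := eqVneq (k v) d; last by apply: Pf; rewrite face_gem_mem in vg.
apply/eqP/negPn/negP => ne.
pose c := (perm inj)^-1%g (k' v).
have cd : c != k v by apply: contraNneq ne => <-; rewrite permKV.
have [u ug ku] := face_color sT kT c hg.
have uf : u \in f by rewrite face_gem_mem // ku -kv in ug.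
have := Pf u uf; rewrite ku permKV => /(face_inj kT' hg ug vg) e.
by rewrite -ku e eqxx in cd.
Qed.

Lemma face_gem_recolor (T : complex) (k k' : T -> 'I_3) : surface_complex T ->
  proper_coloring k -> proper_coloring k' ->
  giso (face_gem k) (face_gem k').
Proof.
move=> sT kT kT'; have [s hs] := coloring_unique sT kT kT'.
exists s, id, id; split=> // [f|f|c f _]; first by rewrite !alive_face.
  by rewrite !alive_face.
rewrite /face_gem (_ : [set v in f | k' v != s c] = [set v in f | k v != c]) //.
by apply/setP => v; rewrite !inE hs (inj_eq perm_inj).
Qed.

Section GisoIsomorphic.
Variables (T T' : complex) (k : T -> 'I_3) (k' : T' -> 'I_3).
Hypotheses (sT : surface_complex T) (kT : proper_coloring k).
Hypotheses (sT' : surface_complex T') (kT' : proper_coloring k').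

(** A vertex is a two-coloured cycle of faces. Its image is chosen in the image of one face of the
    star; crossing an edge at [v] changes only a vertex of another colour, so it lies in the images
    of all of them. *)
Lemma giso_vertex s f g : giso_by s f g (face_gem k) (face_gem k') ->
  exists phi : T -> T', forall v, k' (phi v) = s (k v) /\
    forall F, F \in faces T -> v \in F -> phi v \in f F.
Proof.
move=> [af _ _ _ cm]; apply: (@fin_all_exists T (fun=> T')
  (fun v w => k' w = s (k v) /\ forall F, F \in faces T -> v \in F ->
    w \in f F)) => v.
have [_ /(_ v)[F0 hF0 vF0] _ _ _] := sT.
have aF F : F \in faces T -> f F \in faces T'.
  by rewrite -(alive_face sT kT) => /af; rewrite alive_face.
have [w wF kw] := face_color sT' kT' (s (k v)) (aF _ hF0).
exists w; split=> //; apply: (star_ind sT kT hF0) => // F d hF vF dv wfF.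
rewrite cm ?alive_face // face_gem_mem ?aF // kw (inj_eq perm_inj) eq_sym //.
Qed.
End GisoIsomorphic.

(** The vertex maps of the isomorphism and of its inverse cancel, because in a given face a vertex
    is determined by its colour. *)
Lemma giso_isomorphic (T T' : complex) (k : T -> 'I_3) (k' : T' -> 'I_3) :
  surface_complex T -> proper_coloring k ->
  surface_complex T' -> proper_coloring k' ->
  giso (face_gem k) (face_gem k') -> isomorphic T T'.
Proof.
move=> sT kT sT' kT' [s [f [g iso]]].
have iso' := giso_by_sym (face_gem_gem sT kT) (face_gem_gem sT' kT') iso.
have [phi hphi] := giso_vertex sT kT sT' kT' iso.
have [psi hpsi] := giso_vertex sT' kT' sT kT iso'.
have [af ag fK gK _] := iso.
have aF F : F \in faces T -> f F \in faces T'.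
  by rewrite -(alive_face sT kT) => /af; rewrite alive_face.
have aG G : G \in faces T' -> g G \in faces T.
  by rewrite -(alive_face sT' kT') => /ag; rewrite alive_face.
have phiK : cancel phi psi.
  move=> v; have [_ /(_ v)[F hF vF] _ _ _] := sT.
  apply: (face_inj kT hF) => //.
    have /= := (hpsi (phi v)).2 (f F) (aF _ hF) ((hphi v).2 _ hF vF).
    by rewrite fK // alive_face.
  by rewrite (hpsi _).1 (hphi _).1 permK.
have psiK : cancel psi phi.
  move=> v; have [_ /(_ v)[F hF vF] _ _ _] := sT'.
  apply: (face_inj kT' hF) => //.
    have /= := (hphi (psi v)).2 (g F) (aG _ hF) ((hpsi v).2 _ hF vF).
    by rewrite gK // alive_face.
  by rewrite (hphi _).1 (hpsi _).1 permKV.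
have imF F : F \in faces T -> phi @: F = f F.
  move=> hF; apply/eqP; rewrite eqEcard (card_imset _ (can_inj phiK)).
  rewrite (face_card sT hF) (face_card sT' (aF _ hF)) leqnn andbT.
  by apply/subsetP => _ /imsetP[v vF ->]; exact: (hphi v).2.
have imG G : G \in faces T' -> psi @: G = g G.
  move=> hG; apply/eqP; rewrite eqEcard (card_imset _ (can_inj psiK)).
  rewrite (face_card sT' hG) (face_card sT (aG _ hG)) leqnn andbT.
  by apply/subsetP => _ /imsetP[v vF ->]; exact: (hpsi v).2.
exists phi; split=> [|F]; first by exists psi.
apply/idP/idP => [hF|hF]; first by rewrite imF // aF.
have -> : F = psi @: (phi @: F).
  by rewrite -imset_comp (eq_imset _ phiK) imset_id.
by rewrite imG // aG.
Qed.

Lemma isomorphic_sym T T' : isomorphic T T' -> isomorphic T' T.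
Proof.
move=> [phi [[psi phiK psiK] hf]]; exists psi; split; first by exists phi.
by move=> f; rewrite hf -imset_comp (eq_imset _ psiK) imset_id.
Qed.

Lemma isomorphic_trans T T' T'' :
  isomorphic T T' -> isomorphic T' T'' -> isomorphic T T''.
Proof.
move=> [phi [b hf]] [phi' [b' hf']]; exists (phi' \o phi).
by split=> [|f]; [exact: (bij_comp b' b)|rewrite hf hf' imset_comp].
Qed.

(** * Degrees in face subdivisions *)

Definition sparse (T : complex) := forall f (u v : T), f \in faces T ->
  u \in f -> v \in f -> u != v -> (4 < #|star u|) || (4 < #|star v|).

Lemma isomorphic_sparse T T' : isomorphic T T' -> sparse T' -> sparse T.
Proof.
move=> [phi [[psi phiK psiK] hf]] sp.
have inj := can_inj phiK.
have st v : #|star (phi v)| = #|star v|.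
  rewrite -(card_imset _ (imset_inj inj)); congr #|pred_of_set _|;
    apply/setP => G.
  apply/idP/imsetP => [|[F]].
    have eG : G = phi @: (psi @: G) by rewrite -imset_comp (eq_imset _ psiK)
      imset_id.
    rewrite inE => /andP[hG vG]; exists (psi @: G) => //; rewrite inE hf -eG hG.
    by rewrite -(phiK v) imset_f.
  by rewrite inE => /andP[hF vF ->]; rewrite inE -hf hF imset_f.
move=> f u v hF uf vf uv; rewrite -(st u) -(st v).
by apply: (sp (phi @: f)); rewrite -?hf ?imset_f ?(inj_eq inj).
Qed.

Lemma tri_perm (V : finType) (a b c : V) :
  [/\ tri a b c = tri b a c, tri a b c = tri a c b & tri a b c = tri c b a].
Proof. by split; apply/setP => v; rewrite !inE; do 3!case: (_ == _). Qed.

(** Each of the at least three edges at [w] lies on two facial cycles, and each such incidence gives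
    its own triangle at [w]: at least six in all. *)
Lemma face_subdivision_star (H : embedded_graph) (w : H) :
  (forall u v : H, gadj u v ->
     #|[set f : gface H | cycle_edge (facial f) u v]| = 2) ->
  irreflexive (@gadj H) -> min_degree_ge 3 H ->
    4 < #|star (inl w : face_subdivision H)|.
Proof.
move=> edge2 irr deg; pose A :=
  [set p : H * gface H | gadj w p.1 && cycle_edge (facial p.2) w p.1].
pose t (p : H * gface H) : {set face_subdivision H} :=
  tri (inr p.2) (inl w) (inl p.1).
have cardA : 6 <= #|A|.
  rewrite -sum1_card (eq_bigl (fun p =>
    gadj w p.1 && cycle_edge (facial p.2) w p.1)); last first.
    by move=> p; rewrite inE.
  rewrite -(pair_big_dep (fun u => gadj w u) (fun u f =>
    cycle_edge (facial f) w u) (fun _ _ => 1)) /=.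
  rewrite (eq_bigr (fun=> 2)); last first.
    move=> u wu; rewrite -(edge2 w u wu) -sum1_card.
    by apply: eq_bigl => f; rewrite inE.
  rewrite sum_nat_const; have := deg w; rewrite cardsE => le.
  by rewrite (_ : 6 = 3 * 2) // leq_mul2r.
apply: leq_trans (_ : #|A| <= _); first exact: ltn_trans cardA.
have inj : {in A &, injective t}.
  move=> [u f] [u' f']; rewrite !inE /= => /andP[wu _] _ /setP e.
  have := e (inr f); rewrite !inE eqxx => /esym /orP[/orP[/eqP[->]|//]|//].
  have := e (inl u); rewrite !inE eqxx ?orbT =>
    /esym /orP[/orP[//|/eqP[ew]]|/eqP[->]//].
  by rewrite ew irr in wu.
rewrite -(card_in_imset inj); apply/subset_leq_card/subsetP =>
  _ /imsetP[[u f] hp ->].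
move: hp; rewrite inE /= => /andP[_ ce]; rewrite !inE eqxx ?orbT andbT.
by apply/existsP; exists f; apply/existsP; exists w; apply/existsP; exists u;
  rewrite ce eqxx.
Qed.

(** A triangle has only one vertex that comes from a face of [H], so one of two distinct vertices is
    a vertex of [H]. *)
Lemma face_subdivision_sparse (H : embedded_graph) :
  (forall u v : H, gadj u v ->
     #|[set f : gface H | cycle_edge (facial f) u v]| = 2) ->
  irreflexive (@gadj H) -> min_degree_ge 3 H -> sparse (face_subdivision H).
Proof.
move=> edge2 irr deg f u v; rewrite inE =>
  /existsP[g /existsP[x /existsP[y /andP[_ /eqP ->]]]].
have big w := face_subdivision_star w edge2 irr deg.
rewrite !inE -!orbA => /or3P[/eqP -> | /eqP -> | /eqP -> ].
- case/or3P => /eqP ->; rewrite ?eqxx // ?big ?orbT //.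
- by rewrite big.
- by rewrite big.
Qed.

(** * Subdivisions *)

Lemma giso_intro (X : finType) (Y : eqType) (x0 : X) (r : 'I_3 -> X -> X)
    (r' : 'I_3 -> Y -> Y) (f : X -> Y) :
  (forall x, alive r x -> alive r' (f x)) ->
  {in alive r &, injective f} ->
  (forall y, alive r' y -> exists2 x, alive r x & f x = y) ->
  (forall c x, alive r x -> f (r c x) = r' c (f x)) -> giso r r'.
Proof.
move=> af inj sur cm.
(* The default [x0] is never met at an alive [y], since such a [y] has a preimage. *)
pose g y := odflt x0 [pick x | alive r x && (f x == y)].
have gP y : alive r' y -> alive r (g y) /\ f (g y) = y.
  move=> /sur[x ax e]; rewrite /g; case: pickP =>
    [x' /andP[ax' /eqP e'] //|/(_ x)].
  by rewrite ax e eqxx.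
exists 1%g, f, g; split=> // [y|x ax|y|c x].
- by case/gP.
- by apply: inj => //; have [] := gP _ (af _ ax).
- by case/gP.
- by rewrite perm1; exact: cm.
Qed.

(** [D] holds the faces destroyed by the subdivision, and [h] names the survivor of [q] that stands
    for each of them. *)
Lemma subdivision_giso (T T' : complex) (k : T -> 'I_3) (i : T -> T')
    (D : {set {set T}}) (h : {set T} -> {set T'})
    (q : 'I_3 -> {set T'} -> {set T'})
    (f := fun F => if F \in D then h F else i @: F) :
  surface_complex T -> proper_coloring k -> is_gem q ->
  (forall F, F \in faces T -> alive q (f F)) ->
  {in faces T &, injective f} ->
  (forall G, alive q G -> exists2 F, F \in faces T & f F = G) ->
  (forall F c, F \in faces T -> F \in D -> q c (f F) = f (face_gem k c F)) ->
  (forall F c, F \in faces T -> F \notin D -> face_gem k c F \notin D ->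
     q c (i @: F) = i @: face_gem k c F) ->
  giso q (face_gem k).
Proof.
move=> sT kT hq af inj sur onD offD; apply: giso_sym => //.
  exact: face_gem_gem.
apply: (@giso_intro _ _ set0 _ _ f) => [F||G|c F]; rewrite ?alive_face //.
- exact: af.
- by move=> F G; rewrite /in_mem /= !alive_face //; exact: inj.
- by case/sur => F hF <-; exists F => //; rewrite alive_face.
move=> hF; have hF' : face_gem k c F \in faces T by rewrite face_gem_in.
case: (boolP (F \in D)) => FD; first by rewrite onD.
(* Entering [D] from outside is the inverse of leaving it, which [onD] covers. *)
case: (boolP (face_gem k c F \in D)) => FD'.
  have := onD _ c hF' FD'; rewrite (face_gemK sT kT) => <-.
  by rewrite (gemK hq).
by rewrite {2}/f (negbTE FD) offD // /f (negbTE FD').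
Qed.

Section Tri.
Variables (T : complex) (k : T -> 'I_3).
Hypotheses (sT : surface_complex T) (kT : proper_coloring k).

Lemma tri_uniq (x y z : T) : tri x y z \in faces T -> uniq [:: x; y; z].
Proof.
move/(face_card sT) => e; apply/card_uniqP; rewrite /= -e.
by apply: eq_card => v; rewrite !inE orbA.
Qed.

Lemma gem_tri3 (x y z z' : T) c : tri x y z \in faces T ->
  tri x y z' \in faces T ->
  z' != z -> k z = c -> face_gem k c (tri x y z) = tri x y z'.
Proof.
move=> h h' zz' <-; apply: face_gem_eq => //.
  have U := tri_uniq h; uniq_cases U; apply/eqP => /setP/(_ z).
  by rewrite !inE eqxx ?orbT => /orP[/orP[]|]/eqP e; congruence.
by move=> v; rewrite !inE => /orP[-> //|/eqP ->]; rewrite eqxx.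
Qed.

Lemma gem_tri2 (x y z y' : T) c : tri x y z \in faces T ->
  tri x y' z \in faces T ->
  y' != y -> k y = c -> face_gem k c (tri x y z) = tri x y' z.
Proof.
have [_ -> _] := tri_perm x y z; have [_ -> _] := tri_perm x y' z.
exact: gem_tri3.
Qed.

Lemma gem_tri1 (x y z x' : T) c : tri x y z \in faces T ->
  tri x' y z \in faces T ->
  x' != x -> k x = c -> face_gem k c (tri x y z) = tri x' y z.
Proof.
have [_ _ ->] := tri_perm x y z; have [_ _ ->] := tri_perm x' y z.
exact: gem_tri3.
Qed.
End Tri.

Lemma image_gem (T T' : complex) (k : T -> 'I_3) (k' : T' -> 'I_3) (i : T -> T')
    (F : {set T}) c :
  surface_complex T -> proper_coloring k ->
  surface_complex T' -> proper_coloring k' ->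
  injective i -> (forall v, k' (i v) = k v) ->
  F \in faces T -> i @: F \in faces T' -> i @: face_gem k c F \in faces T' ->
  face_gem k' c (i @: F) = i @: face_gem k c F.
Proof.
move=> sT kT sT' kT' inj kk hF h1 h2.
have [_ ne sub] := face_gemP sT kT c hF.
apply: face_gem_eq => //; first by rewrite (inj_eq (imset_inj inj)).
by move=> _ /imsetP[v vF ->]; rewrite kk => kv; rewrite imset_f // sub.
Qed.

Section BT.
Variables (T T' : complex) (i : T -> T') (a b c : T) (a' b' c' : T').
Variables (k : T -> 'I_3) (k' : T' -> 'I_3).
Hypotheses (sT : surface_complex T) (kT : proper_coloring k).
Hypotheses (sT' : surface_complex T') (kT' : proper_coloring k').
Hypotheses (habc : tri a b c \in faces T) (inj : injective i).
Hypotheses (news : uniq [:: a'; b'; c'])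
  (old : forall x, (x \in [:: a'; b'; c']) = (x \notin codom i)).
Hypotheses (kk : forall v, k' (i v) = k v)
  (ka : k' a' = k a) (kb : k' b' = k b) (kc : k' c' = k c).
Hypothesis fT' : faces T' = image_faces i (faces T :\ tri a b c) :|:
  [set tri (i a) (i b) c'; tri (i a) b' (i c); tri a' (i b) (i c);
       tri (i a) b' c'; tri a' (i b) c'; tri a' b' (i c); tri a' b' c'].

(* Tells the seven new faces apart from each other and from the old ones. *)
Let sig (G : {set T'}) := (a' \in G, b' \in G, c' \in G).

(** The middle rung joins the central triangle [o] to [n_a]. The contraction deletes [o], [n_b],
    [n_a], [m_ab] and makes [n_c], [m_bc] a dipole; after its cancellation [m_ac] stands for the old
    face. *)
Lemma BT_reduces : reduces (face_gem k') (face_gem k).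
Proof.
have nw x : x \in [:: a'; b'; c'] -> forall v, (x == i v) = false.
  rewrite old => nx v; apply: contraNF nx => /eqP ->; exact: codom_f.
have na : forall v, (a' == i v) = false by apply: nw; rewrite !inE eqxx.
have nb : forall v, (b' == i v) = false by apply: nw; rewrite !inE eqxx orbT.
have nc : forall v, (c' == i v) = false by apply: nw; rewrite !inE eqxx !orbT.
have [ab ac bc] : [/\ (a' == b') = false, (a' == c') = false &
  (b' == c') = false].
  by uniq_cases news; split; apply/eqP.
have [ba ca cb] : [/\ (b' == a') = false, (c' == a') = false &
  (c' == b') = false].
  by rewrite ![_ == a']eq_sym [c' == b']eq_sym.
pose E := (na, nb, nc, (ab, ac, bc), (ba, ca, cb), eqxx).
set o := tri a' b' c'; set n_a := tri (i a) b' c'; set n_b := tri a' (i b) c'.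
set n_c := tri a' b' (i c); set m_ab := tri (i a) (i b) c'.
set m_ac := tri (i a) b' (i c); set m_bc := tri a' (i b) (i c).
have so : sig o = (true, true, true) by rewrite /sig !inE !E.
have sna : sig n_a = (false, true, true) by rewrite /sig !inE !E.
have snb : sig n_b = (true, false, true) by rewrite /sig !inE !E.
have snc : sig n_c = (true, true, false) by rewrite /sig !inE !E.
have smab : sig m_ab = (false, false, true) by rewrite /sig !inE !E.
have smac : sig m_ac = (false, true, false) by rewrite /sig !inE !E.
have smbc : sig m_bc = (true, false, false) by rewrite /sig !inE !E.
have sim (F : {set T}) : sig (i @: F) = (false, false, false).
  by rewrite /sig; congr (_, _, _); apply/imsetP => -[v _ /eqP]; rewrite !E.
pose S := (so, sna, snb, snc, smab, smac, smbc, sim).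
have sne G G' : sig G != sig G' -> G != G' by apply: contraNneq => ->.
have nin G (s : seq {set T'}) : sig G \notin map sig s -> G \notin s.
  by apply: contraNN; exact: map_f.
have [ho hna hnb hnc] : [/\ o \in faces T', n_a \in faces T',
  n_b \in faces T' & n_c \in faces T'].
  by rewrite fT' !inE !eqxx ?orbT.
have [hmab hmac hmbc] : [/\ m_ab \in faces T', m_ac \in faces T' &
  m_bc \in faces T'].
  by rewrite fT' !inE !eqxx ?orbT.
have him F : F \in faces T -> F != tri a b c -> i @: F \in faces T'.
  by move=> hF ne; rewrite fT' inE imset_f // !inE ne.
have cases G : G \in faces T' -> G \in [:: o; n_a; n_b; n_c; m_ab; m_ac;
  m_bc] \/
    exists2 F, F \in faces T :\ tri a b c & G = i @: F.
  rewrite fT' inE => /orP[/imsetP[F hF ->]|hG]; [by right; exists F|left].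
  move: hG; rewrite !inE -!orbA -/o -/n_a -/n_b -/n_c -/m_ab -/m_ac -/m_bc.
  by do 7! case: (G == _); rewrite ?orbT.
set r := face_gem k'; have gr : is_gem r := face_gem_gem sT' kT'.
have U := tri_uniq sT habc.
have cu : uniq [:: k a; k b; k c].
  have -> : [:: k a; k b; k c] = map k [:: a; b; c] by [].
  rewrite map_inj_in_uniq //.
  by move=> u v hu hv; apply: (face_inj kT habc); rewrite !inE -orbA;
    move: hu hv; rewrite !inE.
have ra : r (k a) o = n_a /\ r (k a) n_b = m_ab /\ r (k a) n_c = m_ac.
  by do !split; apply: gem_tri1; rewrite // eq_sym na.
have rb : r (k b) o = n_b /\ r (k b) n_a = m_ab /\ r (k b) n_c = m_bc.
  by do !split; apply: gem_tri2; rewrite // eq_sym nb.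
have rc : r (k c) o = n_c /\ r (k c) n_a = m_ac /\ r (k c) n_b = m_bc.
  by do !split; apply: gem_tri3; rewrite // eq_sym nc.
case: ra => ao [anb anc]; case: rb => bo [bna bnc]; case: rc => co [cna cnb].
have Kr := gemK gr.
have lad : ladder r (k a) (k b) (k c) o.
  by split; rewrite ?alive_face // ?ao ?bo ?co ?anb ?bna ?anc ?cna //;
    apply/eqP/sne; rewrite !S.
(* Both sides of the required square are [m_bc]. *)
have [dip e] := ladder_corner_dipole gr lad (etrans (etrans (congr1 _ bo) cnb)
  (esym (etrans (congr1 _ co) bnc))).
set q1 := contract r (k a) (k b) o in dip e.
rewrite co bnc in dip e.
pose q := excise q1 n_c m_bc.
have st : steps r q.
  apply: steps_step (step_ladder lad) _.
  by apply: steps_step (steps_refl _); rewrite /q -e; exact: step_dipole dip.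
have q1E : q1 = excise (excise r o n_b) n_a m_ab by rewrite /q1 /contract bo ao
  bna.
have gq1 : is_gem q1 := contract_gem gr lad.
have gq : is_gem q := steps_gem gr st.
have al G : alive q G = (G \in faces T') && (G \notin [:: o; n_b; n_a; m_ab;
  n_c; m_bc]).
  have ne1 : o != n_b by apply: sne; rewrite !S.
  have ne2 : n_a != m_ab by apply: sne; rewrite !S.
  have ne3 : n_c != m_bc by apply: sne; rewrite !S.
  have g1 : is_gem (excise r o n_b) by apply: excise_gem; rewrite ?alive_face.
  rewrite /q (alive_excise _ gq1 ne3) q1E (alive_excise _ g1 ne2) (alive_excise
    _ gr ne1).
  by rewrite (alive_face sT' kT') !inE !negb_or -!andbA.
have qE : q = excise (excise (excise r o n_b) n_a m_ab) n_c m_bc.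
  exact: (congr1 (fun z => excise z n_c m_bc) q1E).
exists q; first exact: st.
clearbody q; clear q1 dip e st q1E gq1.
apply: (@subdivision_giso _ _ k i [set tri a b c] (fun=> m_ac) q sT kT gq).
- move=> F hF; rewrite inE al; case: eqP => [_|/eqP ne].
    by rewrite hmac /=; apply: nin; rewrite /= !S.
  by rewrite him //=; apply: nin; rewrite /= !S.
- move=> F G hF hG; rewrite !inE; case: eqP => [->|_]; case: eqP => [-> //|_].
  + by move/(congr1 sig); rewrite !S.
  + by move/(congr1 sig); rewrite !S.
  + exact: imset_inj.
- move=> G; rewrite al => /andP[/cases[hG|[F hF ->]] nG].
    exists (tri a b c); rewrite // inE eqxx.
    by move: hG nG; rewrite !inE; do 7! case: eqP => //= _; move=> ->.
  move: hF; rewrite !inE => /andP[ne hF]; exists F => //.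
  by rewrite inE (negbTE ne).
- move=> F d hF; rewrite !inE => /eqP ->; rewrite eqxx.
  have hd e' : face_gem k e' (tri a b c) \in faces T /\
    face_gem k e' (tri a b c) != tri a b c.
    by have [] := face_gemP sT kT e' habc.
  have [hd1 hd2] := hd d; rewrite (negbTE hd2).
  have out (G : {set T'}) e' : G \in faces T' -> sig G != (false, false,
    false) ->
     (forall v, v \in G -> k' v != e' -> exists2 u, u \in tri a b c &
       v = i u) ->
     r e' G = i @: face_gem k e' (tri a b c).
    move=> hG sG sub; have [h1 h2] := hd e'; apply: face_gem_eq => //.
    - exact: him.
    - by apply: sne; rewrite !S eq_sym.
    move=> v vG kv; have [u ut ev] := sub v vG kv.
    by rewrite ev imset_f // face_gem_mem // -kk -ev.
  (* Across [b] the survivor [m_ac] keeps its own outer edge. Across [a] and [c] it takes over those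
     of [m_bc] and [m_ab], which were excised with its neighbours [n_c] and [n_a]. *)
  rewrite qE; case: (colors3 cu d) => ->.
  + have e1 : r (k a) m_bc = i @: face_gem k (k a) (tri a b c).
      apply: out; rewrite ?S // => v; rewrite !inE -orbA => /or3P[]/eqP -> kv.
      - by rewrite ka eqxx in kv.
      - by exists b; rewrite // !inE eqxx ?orbT.
      - by exists c; rewrite // !inE eqxx ?orbT.
    have e2 : r (k a) m_ac = n_c by rewrite -anc Kr.
    rewrite excise_through; last first.
    + by rewrite !excise_out ?e2 //; apply: nin; rewrite /= !S.
    + by apply: nin; rewrite /= !S.
    by rewrite !excise_out ?e1 //; apply: nin; rewrite /= !S.
  + have e1 : r (k b) m_ac = i @: face_gem k (k b) (tri a b c).
      apply: out; rewrite ?S // => v; rewrite !inE -orbA => /or3P[]/eqP -> kv.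
      - by exists a; rewrite // !inE eqxx ?orbT.
      - by rewrite kb eqxx in kv.
      - by exists c; rewrite // !inE eqxx ?orbT.
    by rewrite !excise_out ?e1 //; apply: nin; rewrite /= !S.
  + have e1 : r (k c) m_ab = i @: face_gem k (k c) (tri a b c).
      apply: out; rewrite ?S // => v; rewrite !inE -orbA => /or3P[]/eqP -> kv.
      - by exists a; rewrite // !inE eqxx ?orbT.
      - by exists b; rewrite // !inE eqxx ?orbT.
      - by rewrite kc eqxx in kv.
    have e2 : r (k c) m_ac = n_a by rewrite -cna Kr.
    have e3 : excise (excise r o n_b) n_a m_ab (k c) m_ac = i @: face_gem k (k
      c) (tri a b c).
      rewrite excise_through; first by rewrite excise_out ?e1 //; apply: nin;
        rewrite /= !S.
      + by apply: nin; rewrite /= !S.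
      by rewrite excise_out ?e2 //; apply: nin; rewrite /= !S.
    by rewrite excise_out ?e3 //; apply: nin; rewrite /= !S.
- move=> F d hF; rewrite !inE => ne ne'.
  have e1 : r d (i @: F) = i @: face_gem k d F.
    by apply: image_gem => //; apply: him; rewrite ?face_gem_in.
  by rewrite qE !excise_out ?e1 //; apply: nin; rewrite /= !S.
Qed.
End BT.

Section BE.
Variables (T T' : complex) (i : T -> T') (a b s w : T) (p q : T').
Variables (k : T -> 'I_3) (k' : T' -> 'I_3).
Hypotheses (sT : surface_complex T) (kT : proper_coloring k).
Hypotheses (sT' : surface_complex T') (kT' : proper_coloring k').
Hypotheses (ab : a != b) (hasw : tri a s w \in faces T)
  (hbsw : tri b s w \in faces T) (inj : injective i).
Hypotheses (news : uniq [:: p; q])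
  (old : forall x, (x \in [:: p; q]) = (x \notin codom i)).
Hypotheses (kk : forall v, k' (i v) = k v) (kp : k' p = k s) (kq : k' q = k w).
Hypothesis fT' : faces T' =
  (image_faces i (faces T :\ tri a s w :\ tri b s w) :|:
   [set tri (i a) (i s) q; tri (i a) p q; tri (i a) p (i w);
        tri (i b) (i s) q; tri (i b) p q; tri (i b) p (i w)]).

(* Tells the six new faces apart from each other and from the old ones. *)
Let sig (G : {set T'}) := (p \in G, q \in G, i a \in G).

(** The three rungs join the triangles at [a] to those at [b], with [apq] and [bpq] in the middle.
    The contraction towards [s] leaves [apw] and [bpw], which stand for the two old faces. *)
Lemma BE_reduces : reduces (face_gem k') (face_gem k).
Proof.
have nw x : x \in [:: p; q] -> forall v, (x == i v) = false.
  rewrite old => nx v; apply: contraNF nx => /eqP ->; exact: codom_f.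
have np : forall v, (p == i v) = false by apply: nw; rewrite !inE eqxx.
have nq : forall v, (q == i v) = false by apply: nw; rewrite !inE eqxx orbT.
have np' v : (i v == p) = false by rewrite eq_sym np.
have nq' v : (i v == q) = false by rewrite eq_sym nq.
have pq : (p == q) = false by uniq_cases news; apply/eqP.
have qp : (q == p) = false by rewrite eq_sym.
have Ua := tri_uniq sT hasw; have Ub := tri_uniq sT hbsw.
have [as_ aw] : a != s /\ a != w by uniq_cases Ua; split; apply/eqP.
have ii u v : (i u == i v) = (u == v) := inj_eq inj u v.
pose E := (np, nq, np', nq', pq, qp, ii, negbTE ab, negbTE as_, negbTE aw,
  eqxx).
set asq := tri (i a) (i s) q; set apq := tri (i a) p q; set apw :=
  tri (i a) p (i w).
set bsq := tri (i b) (i s) q; set bpq := tri (i b) p q; set bpw :=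
  tri (i b) p (i w).
have s1 : sig asq = (false, true, true) by rewrite /sig !inE !E.
have s2 : sig apq = (true, true, true) by rewrite /sig !inE !E.
have s3 : sig apw = (true, false, true) by rewrite /sig !inE !E.
have s4 : sig bsq = (false, true, false) by rewrite /sig !inE !E.
have s5 : sig bpq = (true, true, false) by rewrite /sig !inE !E.
have s6 : sig bpw = (true, false, false) by rewrite /sig !inE !E.
have sim (F : {set T}) : sig (i @: F) = (false, false, a \in F).
  by rewrite /sig (mem_imset _ _ inj); congr (_, _, _); apply/imsetP =>
    -[v _ /eqP]; rewrite !E.
pose S := (s1, s2, s3, s4, s5, s6, sim).
have sne G G' : sig G != sig G' -> G != G' by apply: contraNneq => ->.
have nin G (l : seq {set T'}) : sig G \notin map sig l -> G \notin l.
  by apply: contraNN; exact: map_f.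
have [h1 h2 h3] : [/\ asq \in faces T', apq \in faces T' & apw \in faces T'].
  by rewrite fT' !inE !eqxx ?orbT.
have [h4 h5 h6] : [/\ bsq \in faces T', bpq \in faces T' & bpw \in faces T'].
  by rewrite fT' !inE !eqxx ?orbT.
pose A := tri a s w; pose B := tri b s w.
have [fA fB] : A \in faces T /\ B \in faces T by [].
pose D := [set A; B].
have him F : F \in faces T -> F \notin D -> (i @: F) \in faces T'.
  by move=> hF; rewrite fT' -/A -/B !inE negb_or => /andP[nA nB];
    rewrite imset_f // !inE nA nB.
have cases G : G \in faces T' -> G \in [:: asq; apq; apw; bsq; bpq; bpw] \/
    exists2 F, F \in faces T & F \notin D /\ G = (i @: F).
  rewrite fT' -/A -/B inE => /orP[/imsetP[F hF ->]|hG]; [right|left].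
    by move: hF; rewrite !inE => /and3P[nB nA hF]; exists F;
      rewrite // !inE negb_or nA nB.
  move: hG; rewrite !inE -!orbA -/asq -/apq -/apw -/bsq -/bpq -/bpw.
  by do 6! case: (G == _); rewrite ?orbT.
set r := face_gem k'; have gr : is_gem r := face_gem_gem sT' kT'.
have cu : uniq [:: k a; k s; k w].
  have -> : [:: k a; k s; k w] = map k [:: a; s; w] by [].
  rewrite map_inj_in_uniq //.
  by move=> u v hu hv; apply: (face_inj kT hasw); rewrite !inE -orbA;
    move: hu hv; rewrite !inE.
(* Both [a] and [b] avoid the colours of [s] and [w]. *)
have kab : k b = k a.
  have cu' : uniq [:: k b; k s; k w].
    have -> : [:: k b; k s; k w] = map k [:: b; s; w] by [].
    rewrite map_inj_in_uniq //.
    by move=> u v hu hv; apply: (face_inj kT hbsw); rewrite !inE -orbA;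
      move: hu hv; rewrite !inE.
  by uniq_cases cu'; case: (colors3 cu (k b)) => // e; congruence.
have ba : b != a by rewrite eq_sym.
have ka := kk a.
have ra : r (k a) apq = bpq /\ r (k a) asq = bsq /\ r (k a) apw = bpw.
  by do !split; apply: gem_tri1; rewrite // ii.
have rs : r (k s) apq = asq /\ r (k s) bpq = bsq.
  by do !split; apply: gem_tri2; rewrite // np'.
have rw : r (k w) apq = apw /\ r (k w) bpq = bpw.
  by do !split; apply: gem_tri3; rewrite // nq'.
have rA : face_gem k (k a) A = B by apply: gem_tri1.
have rB : face_gem k (k a) B = A by apply: gem_tri1.
case: ra => ao [as' aw']; case: rs => so sb; case: rw => wo wb.
have Kr := gemK gr.
have lad : ladder r (k a) (k s) (k w) apq.
  by split; rewrite ?alive_face // ?ao ?so ?wo ?as' ?sb ?aw' ?wb //;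
    apply/eqP/sne; rewrite !S.
pose z := contract r (k a) (k s) apq.
have st : steps r z by apply: steps_step (step_ladder lad) (steps_refl _).
have zE : z = excise (excise r apq asq) bpq bsq by rewrite /z /contract so ao
  sb.
have gz : is_gem z := contract_gem gr lad.
have al G : alive z G = (G \in faces T') && (G \notin [:: apq; asq; bpq; bsq]).
  have ne1 : apq != asq by apply: sne; rewrite !S.
  have ne2 : bpq != bsq by apply: sne; rewrite !S.
  have g1 : is_gem (excise r apq asq) by apply: excise_gem; rewrite ?alive_face.
  rewrite zE (alive_excise _ g1 ne2) (alive_excise _ gr ne1).
  by rewrite (alive_face sT' kT') !inE !negb_or -!andbA.
have AB : A != B by apply/eqP => /setP/(_ a); rewrite !inE !E.
pose h F := if F == A then apw else bpw.
exists z; first exact: st.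
clearbody z; clear st.
apply: (@subdivision_giso _ _ k i D h z sT kT gz).
- move=> F hF; rewrite al; case: (boolP (F \in D)) => FD.
    by rewrite /h; case: ifP => _; rewrite ?h3 ?h6 /=; apply: nin;
      rewrite /= !S.
  by rewrite him //=; apply: nin; rewrite /= !S.
- move=> F G hF hG; case: (boolP (F \in D)) => FD; case: (boolP (G \in D)) =>
  GD.
  + move: FD GD; rewrite !inE /h => /orP[]/eqP-> /orP[]/eqP-> //;
    rewrite eqxx (eq_sym B) (negbTE AB).
      by move/(congr1 sig); rewrite !S.
    by move/(congr1 sig); rewrite !S.
  + by rewrite /h; case: ifP => _ /(congr1 sig); rewrite !S.
  + by rewrite /h; case: ifP => _ /(congr1 sig); rewrite !S.
  + exact: imset_inj.
- move=> G; rewrite al => /andP[/cases[hG|[F hF [FD ->]]] nG].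
    have [->|->] : G = apw \/ G = bpw.
    + move: nG; rewrite !inE !negb_or =>
      /and4P[/negbTE n1 /negbTE n2 /negbTE n3 /negbTE n4].
      by move: hG; rewrite !inE n1 n2 n3 n4 /= => /orP[]/eqP ->; [left|right].
    + by exists A; rewrite // /h !inE eqxx.
    + by exists B; rewrite // /h !inE eqxx orbT (eq_sym B) (negbTE AB).
  by exists F => //; rewrite (negbTE FD).
(* The two old faces meet across colour [k a]; any other colour leads out of [D], by
   [face_gem_neq]. *)
- have hd F e' : F \in D -> e' != k a -> face_gem k e' F \in faces T /\
  face_gem k e' F \notin D.
    move=> FD ea; have hF : F \in faces T by move: FD; rewrite !inE =>
      /orP[]/eqP ->.
    have [g1 g2 _] := face_gemP sT kT e' hF; split=> //.
    have := face_gem_neq sT kT hF ea.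
    move: FD g2; rewrite !inE => /orP[]/eqP ->; rewrite ?rA ?rB negb_or => ->
      /eqP -> //.
  have out F (G : {set T'}) e' : F \in D -> e' != k a -> G \in faces T' ->
     (p \in G) || (q \in G) ->
     (forall v, v \in G -> k' v != e' -> exists2 u, u \in F & v = i u) ->
     r e' G = (i @: face_gem k e' F).
    move=> FD ea hG sG sub; have [g1 g2] := hd F e' FD ea;
      apply: face_gem_eq => //.
    - exact: him.
    - apply: contraTneq sG => <-; have := sim (face_gem k e' F).
      by rewrite /sig => -[-> -> _].
    have hF : F \in faces T by move: FD; rewrite !inE => /orP[]/eqP ->.
    move=> v vG kv; have [u ut ev] := sub v vG kv.
    by rewrite ev imset_f // face_gem_mem // -kk -ev.
  have [AD BD] : A \in D /\ B \in D by rewrite !inE !eqxx orbT.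
  have hA : h A = apw by rewrite /h eqxx.
  have hB : h B = bpw by rewrite /h eq_sym (negbTE AB).
  have [sa wa] : k s != k a /\ k w != k a by uniq_cases cu; split; apply/eqP;
    congruence.
  have outs : r (k s) apw = (i @: face_gem k (k s) A) /\
              r (k s) bpw = (i @: face_gem k (k s) B).
    split; apply: out; rewrite // ?inE ?eqxx ?orbT // => v;
      rewrite !inE -orbA => /or3P[]/eqP -> kv.
    - by exists a; rewrite // !inE eqxx ?orbT.
    - by rewrite kp eqxx in kv.
    - by exists w; rewrite // !inE eqxx ?orbT.
    - by exists b; rewrite // !inE eqxx ?orbT.
    - by rewrite kp eqxx in kv.
    - by exists w; rewrite // !inE eqxx ?orbT.
  have outw : r (k w) asq = (i @: face_gem k (k w) A) /\
              r (k w) bsq = (i @: face_gem k (k w) B).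
    split; apply: out; rewrite // ?inE ?eqxx ?orbT // => v;
      rewrite !inE -orbA => /or3P[]/eqP -> kv.
    - by exists a; rewrite // !inE eqxx ?orbT.
    - by exists s; rewrite // !inE eqxx ?orbT.
    - by rewrite kq eqxx in kv.
    - by exists b; rewrite // !inE eqxx ?orbT.
    - by exists s; rewrite // !inE eqxx ?orbT.
    - by rewrite kq eqxx in kv.
  case: outs outw => os1 os2 [ow1 ow2].
  move=> F d hF FD; rewrite FD.
  case: (colors3 cu d) => ->.
  + move: FD; rewrite !inE => /orP[]/eqP ->;
    rewrite ?rA ?rB ?AD ?BD ?hA ?hB ?eqxx ?orbT zE.
      by rewrite !excise_out ?aw' //; apply: nin; rewrite /= !S.
    have e1 : r (k a) bpw = apw by rewrite -aw' Kr.
    by rewrite !excise_out ?e1 //; apply: nin; rewrite /= !S.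
  + have [_ /negbTE ->] := hd F _ FD sa.
    move: FD; rewrite !inE => /orP[]/eqP ->; rewrite ?hA ?hB zE.
      by rewrite !excise_out ?os1 //; apply: nin; rewrite /= !S.
    by rewrite !excise_out ?os2 //; apply: nin; rewrite /= !S.
  (* Across [k w] the survivors met [apq] and [bpq]; they take over the outer edges of the faces
     excised with these, [asq] and [bsq]. *)
  + have [_ /negbTE ->] := hd F _ FD wa.
    move: FD; rewrite !inE => /orP[]/eqP ->; rewrite ?hA ?hB zE.
      have e1 : r (k w) apw = apq by rewrite -wo Kr.
      have e2 : excise r apq asq (k w) apw = (i @: face_gem k (k w) A).
        by rewrite excise_through ?ow1 //; apply: nin; rewrite /= !S.
      by rewrite excise_out ?e2 //; apply: nin; rewrite /= !S.
    have e1 : r (k w) bpw = bpq by rewrite -wb Kr.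
    rewrite excise_through; first by rewrite excise_out ?ow2 //; apply: nin;
      rewrite /= !S.
    * by apply: nin; rewrite /= !S.
    by rewrite excise_out ?e1 //; apply: nin; rewrite /= !S.
- move=> F d hF FD FD'.
  have e1 : r d (i @: F) = (i @: face_gem k d F).
    by apply: image_gem => //; apply: him; rewrite ?face_gem_in.
  by rewrite zE !excise_out ?e1 //; apply: nin; rewrite /= !S.
Qed.
End BE.

From mathcomp Require Import all_order all_algebra.
From mathcomp Require Import all_classical all_reals topology normedtype.

(** * Chains of subdivisions and welds *)

Definition colored (T : complex) (k : T -> 'I_3) : Prop :=
  surface_complex T /\ proper_coloring k.

Lemma subdivision_reduces (R : realType) (F : topologicalType) T T' :
  balanced_subdivision R F T T' -> exists (k : T -> 'I_3) (k' : T' -> 'I_3),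
    [/\ colored k, colored k' & reduces (face_gem k') (face_gem k)].
Proof.
case=> -[[sT _] [sT' _]].
  move=> [i [a [b [c [a' [b' [c' [habc [inj news old [k [k' [kT kT' kk [ka kb
    kc]]]]] fT']]]]]]]].
  exists k, k'; split=> //.
  exact: BT_reduces sT kT sT' kT' habc inj news old kk ka kb kc fT'.
move=> [i [a [b [s [w [p [q [[ab hasw hbsw] [inj news old [k [k' [kT kT' kk [kp
  kq]]]]] fT']]]]]]]].
exists k, k'; split=> //.
exact: BE_reduces sT kT sT' kT' ab hasw hbsw inj news old kk kp kq fT'.
Qed.

Lemma reduces_recolor (T : complex) (Y : eqType) (k k' : T ->
  'I_3) (n : 'I_3 -> Y -> Y) :
  colored k -> colored k' -> reduces (face_gem k') n -> reduces (face_gem k) n.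
Proof.
move=> [sT kT] [_ kT']; apply: reduces_giso; try exact: face_gem_gem.
exact: face_gem_recolor.
Qed.

(** Reducing to [n] is invariant along the chain: a subdivision only prepends steps, while for a
    weld it is the uniqueness of the normal form. Each move has its own colouring, reached by
    [reduces_recolor]. *)
Lemma obtained_reduces (R : realType) (F : topologicalType) T T' (Y : eqType)
    (n : 'I_3 -> Y -> Y) :
  is_gem n -> irreducible n -> obtained R F T T' ->
  (exists2 k : T -> 'I_3, colored k & reduces (face_gem k) n) ->
  exists (T'' : complex) (k : T'' -> 'I_3),
    [/\ isomorphic T'' T', colored k & reduces (face_gem k) n].
Proof.
move=> gn irr; elim=> [{}T {}T' iso|{}T T1 {}T' sub _ IH|{}T T1 {}T' sub _ IH]
  [k ck red].
- by exists T, k.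
- have [k0 [k1 [c0 c1 red1]]] := subdivision_reduces sub.
  apply: IH; exists k1 => //; case: red1 => q sq iso.
  apply: (steps_reduces sq); apply: (reduces_giso _ _ iso).
  + exact: steps_gem (face_gem_gem c1.1 c1.2) sq.
  + exact: face_gem_gem c0.1 c0.2.
  exact: reduces_recolor c0 ck red.
- have [k1 [k0 [c1 c0 [q sq iso]]]] := subdivision_reduces sub.
  have g0 := face_gem_gem c0.1 c0.2; have g1 := face_gem_gem c1.1 c1.2.
  have gq := steps_gem g0 sq.
  apply: IH; exists k1 => //.
  apply: (reduces_giso g1 gq (giso_sym gq g1 iso)).
  exact: reduces_steps g0 gn irr (reduces_recolor c0 ck red) sq.
Qed.

Theorem theorem3p1 (R : realType) (F : topologicalType)
    (hF : closed_surface R F) (H K : embedded_graph)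
    (hH : even_embedding R F H) (hK : even_embedding R F K)
    (dH : min_degree_ge 3 H) (dK : min_degree_ge 3 K)
    (nHK : ~ isomorphic (face_subdivision H) (face_subdivision K)) :
  ~ obtained R F (face_subdivision H) (face_subdivision K).
Proof.
move=> ob; have sparseS G : even_embedding R F G -> min_degree_ge 3 G ->
    sparse (face_subdivision G).
  by move=> [[_ irr] _ [e2 _] _ _]; exact: face_subdivision_sparse.
(* A colouring of the starting complex is read off from the first move; a chain without moves is an
   isomorphism, which [nHK] excludes. *)
have col G1 G2 : obtained R F G1 G2 -> isomorphic G1 G2 \/ exists k : G1 ->
  'I_3, colored k.
  case=> [T T'|T T1 T' /subdivision_reduces[k [_ [ck _ _]]] _|
    T T1 T' /subdivision_reduces[_ [k [_ ck _]]] _]; first by left.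
    by right; exists k.
  by right; exists k.
have [//|[k ck]] := col _ _ ob; have [sH kH] := ck.
have irr : irreducible (face_gem k).
  by apply: face_gem_irreducible => //; exact: sparseS.
(* The normal form followed along the chain is the gem of the face subdivision of [H] itself. *)
have [|T [kT' [iso [sT kT] red]]] :=
  obtained_reduces (face_gem_gem sH kH) irr ob.
  by exists k => //; exists (face_gem k); [exact: steps_refl|exact: giso_refl].
(* The end of the chain is sparse as well, so its reduction to the gem of [H] has no steps and is an
   isomorphism. *)
have irrT : irreducible (face_gem kT').
  apply: face_gem_irreducible => //; apply: isomorphic_sparse iso _;
    exact: sparseS.
have isoH := giso_isomorphic sT kT sH kH (reduces_irreducible irrT red).
by apply: nHK; apply: isomorphic_trans (isomorphic_sym isoH) iso.
Qed.
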